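(* Let $\beta_0,\beta_1,\beta_2$ be real numbers with $0<\beta_0<\beta_1<\beta_2$. Then for every $n\ge 2$, if $X^n(t)$ is the crystal growth process on $\{\mathbb{Z}_+\}^n$ with parameters $\beta_0,\beta_1,\beta_2$ and periodic boundary conditions, the Markov process $(\Delta_1X^n(t),\ldots,\Delta_nX^n(t))$, $t\ge 0$, is positive recurrent and its unique invariant measure has exponentially decaying tails.
   Context: $\mathbb{Z}_+=\{0,1,2,\ldots\}$. Define $$r(a,b,c)=\begin{cases}\beta_2,&\text{if } b<\min\{a,c\},\\ \beta_1,&\text{if }\min\{a,c\}\le b<\max\{a,c\},\\ \beta_0,&\text{if }\max\{a,c\}\le b.\end{cases}$$ For $n\ge2$, the crystal growth process with periodic boundary conditions is the continuous-time Markov jump process $X^n(t)=(X^n_1(t),\ldots,X^n_n(t))$ on $\{\mathbb{Z}_+\}^n$ in which, for each $1\le i\le n$, the coordinate $X_i^n(t)$ increases by $1$ at rate $r(X^n_{i-1}(t),X^n_i(t),X^n_{i+1}(t))$, where by convention $X^n_0(t)=X^n_n(t)$ and $X^n_{n+1}(t)=X^n_1(t)$. For $1\le i\le n$ put $\Delta_iX^n(t)=X^n_i(t)-X^n_{i+1}(t)$ (so $\Delta_nX^n(t)=X_n^n(t)-X_1^n(t)$). Since the rates depend only on the differences of neighbouring coordinates, $(\Delta_1X^n(t),\ldots,\Delta_nX^n(t))$ is itself a Markov jump process, with state space $\{z\in\mathbb{Z}^n: z_1+\cdots+z_n=0\}$. ''Invariant measure'' means invariant probability measure. An invariant measure $\pi$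 has exponentially decaying tails if there exist constants $C,\alpha>0$ such that $\pi(\{z:|z_i|\ge k\})\le Ce^{-\alpha k}$ for all $k\in\mathbb{N}$ and all coordinates $i$. *)

(* Defs.v *)
From HB Require Import structures.
From mathcomp Require Import all_boot all_order all_algebra.
From mathcomp Require Import all_classical all_reals all_analysis.

Set Implicit Arguments.
Unset Strict Implicit.
Unset Printing Implicit Defensive.

Import Order.TTheory GRing.Theory Num.Theory.
Import numFieldNormedType.Exports.

Local Open Scope classical_set_scope.
Local Open Scope ring_scope.

(* A Markov process with state space [S] is given by one path map
   [X : R -> Omega -> S] (only times [0 <= t] are meaningful) and a family
   [P x] of laws on [Omega], where [P x] is the law of the process started
   from [x]. *)

(* A pointed type with its power set as sigma-algebra. *)
Definition discrete (T : Type) : Type := T.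

HB.instance Definition _ (T : pointedType) := Pointed.on (discrete T).

Fact discrete_display : measure_display. Proof. exact: default_measure_display. Qed.

HB.instance Definition _ (T : pointedType) :=
  @isMeasurable.Build discrete_display (discrete T) (@discrete_measurable T)
    (@discrete_measurable0 T) (@discrete_measurableC T) (@discrete_measurableU T).

Section MarkovProcess.
Context {R : realType} {d : measure_display} {Omega : measurableType d}.

Definition past (S : Type) (X : R -> Omega -> S) (t : R) : set (set Omega) :=
  <<s [set E | exists s y, 0 <= s <= t /\ E = [set w | X s w = y]] >>.

(* Right-continuous with left limits for the discrete topology on [S], i.e.
   finitely many jumps in every bounded time interval. *)
Definition step_path (S : Type) (f : R -> S) : Prop :=
  (forall t, 0 <= t -> \forall s \near t^'+, f s = f t) /\
  (forall t, 0 < t -> exists y, \forall s \near t^'-, f s = y).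

(* [Q] is the full generator matrix, diagonal included:
   [P_x(X_h = y) = 1_{x = y} + Q x y * h + o(h)] as [h -> 0+]. *)
Record markov_jump_process (S : eqType) (Q : S -> S -> R)
    (P : S -> probability Omega R) (X : R -> Omega -> S) : Prop := {
  mjp_measurable : forall t y, 0 <= t -> measurable [set w | X t w = y];
  mjp_step : forall w, step_path (X ^~ w);
  mjp_start : forall x, P x [set w | X 0 w = x] = 1%E;
  mjp_markov : forall x s t y z (A : set Omega), 0 <= s -> 0 <= t -> past X s A ->
    P x (A `&` [set w | X s w = y] `&` [set w | X (s + t) w = z]) =
    (P x (A `&` [set w | X s w = y]) * P y [set w | X t w = z])%E;
  mjp_rates : forall x y,
    (fine (P x [set w | X h w = y]) - (x == y)%:R) / h @[h --> 0^'+] --> Q x y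
}.

(* The infimum of the times at which [X] is in [x] after having been elsewhere;
   it is [+oo] if there is no such time. *)
Definition return_time (S : Type) (X : R -> Omega -> S) (x : S) (w : Omega) : \bar R :=
  ereal_inf [set t%:E | t in
    [set t | 0 <= t /\ X t w = x /\ exists s, 0 <= s <= t /\ X s w <> x]].

Definition irreducible (S : Type) (P : S -> probability Omega R)
    (X : R -> Omega -> S) : Prop :=
  forall x y, exists t, 0 <= t /\ (0 < P x [set w | X t w = y])%E.

Definition positive_recurrent (S : Type) (P : S -> probability Omega R)
    (X : R -> Omega -> S) : Prop :=
  irreducible P X /\
  forall x, (\int[P x]_w return_time X x w < +oo)%E.

Definition invariant_measure (S : pointedType) (P : S -> probability Omega R)
    (X : R -> Omega -> S) (pi : probability (discrete S) R) : Prop :=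
  forall t (A : set S), 0 <= t ->
    (\int[pi]_x P x [set w | A (X t w)] = pi A)%E.

End MarkovProcess.

(* Coordinates [1, ..., n] are represented by ['I_n]; [ord_pred] and [ordS] are
   cyclic, which implements the periodic boundary conditions. *)

Definition crystal_rate (R : realType) (b0 b1 b2 : R) (a b c : nat) : R :=
  if (b < minn a c)%N then b2 else if (b < maxn a c)%N then b1 else b0.

Definition config (n : nat) : Type := {ffun 'I_n -> nat}.
HB.instance Definition _ n := Countable.on (config n).

Definition grow n (x : config n) (i : 'I_n) : config n :=
  [ffun j => (x j + (j == i))%N].

(* [(L f)(x) = \sum_i r_i(x) (f (x + e_i) - f x)] at [f] the indicator of [y]. *)
Definition crystal_generator (R : realType) (b0 b1 b2 : R) n (x y : config n) : R :=
  \sum_(i < n) crystal_rate b0 b1 b2 (x (ord_pred i)) (x i) (x (ordS i)) *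
    ((grow x i == y)%:R - (x == y)%:R).

Definition crystal_growth_process (R : realType) (b0 b1 b2 : R) n
    d (Omega : measurableType d)
    (P : config n -> probability Omega R) (X : R -> Omega -> config n) : Prop :=
  markov_jump_process (@crystal_generator R b0 b1 b2 n) P X.

Definition zero_sum n (z : {ffun 'I_n -> int}) : bool := \sum_(i < n) z i == 0.

Definition dstate (n : nat) : Type := {z : {ffun 'I_n -> int} | zero_sum z}.
HB.instance Definition _ n := SubCountable.on (dstate n).

Fact zero_sum0 n : zero_sum ([ffun=> 0] : {ffun 'I_n -> int}).
Proof. by rewrite /zero_sum big1 // => i _; rewrite ffunE. Qed.

HB.instance Definition _ n :=
  isPointed.Build (dstate n) (exist (@zero_sum n) _ (zero_sum0 n)).

Definition neighbour_diff n (x : config n) : {ffun 'I_n -> int} :=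
  [ffun i => (x i)%:Z - (x (ordS i))%:Z].

Fact neighbour_diff_zero_sum n (x : config n) : zero_sum (neighbour_diff x).
Proof.
rewrite /zero_sum; under eq_bigr do rewrite ffunE.
rewrite big_split/= sumrN subr_eq0; apply/eqP.
by rewrite (reindex (@ordS n)) //; exact/onW_bij/ordS_bij.
Qed.

Definition Delta n (x : config n) : dstate n :=
  exist (@zero_sum n) (neighbour_diff x) (neighbour_diff_zero_sum x).

Definition exponentially_decaying_tails (R : realType) n
    (pi : probability (discrete (dstate n)) R) : Prop :=
  exists C alpha : R, [/\ 0 < C, 0 < alpha &
    forall (k : nat) (i : 'I_n),
      (pi [set z : dstate n | (k%:Z <= `|val z i|)%R] <= (C * expR (- (alpha * k%:R)))%:E)%E].

(* Main.v *)
Require Import Defs.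
From HB Require Import structures.
From mathcomp Require Import all_boot all_order all_algebra.
From mathcomp Require Import all_classical all_reals all_analysis.
From mathcomp Require Import measurable_realfun.
From mathcomp Require Import zify ring lra.

Set Implicit Arguments.
Unset Strict Implicit.
Unset Printing Implicit Defensive.

Import Order.TTheory GRing.Theory Num.Theory.
Import numFieldNormedType.Exports.

Local Open Scope classical_set_scope.
Local Open Scope ring_scope.

(** Write [gen] for the generator. A positive difference [z_j = x_j - x_{j+1}]
does not drift upwards, and it drifts downwards at rate at least [b1 - b0] if
the preceding difference is not positive. Summing the products of [z_j^+] and
[min (z_j^+) (z_{j-k}^+)] with weights [eps ^ k] gives a function [V] whose
drift is at most [G - c * sum_j z_j^+]. As [sqrt (1 + V)] has bounded jumps,
[W = exp (delta * sqrt (1 + V))] satisfies [gen W <= G - a * W], while it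
dominates [exp (s * |z_i|)].

As the rates are bounded, the semigroup of [X] is the uniform limit of powers of
the Euler steps [1 + h * gen]. It follows that the law of the differences
depends on the initial configuration only through its differences, and that any
mean on bounded functions that annihilates the range of [gen] is stationary.
Such a mean is an ultrafilter limit of Cesaro means along the iterates of one
Euler step; the bound on [W] makes it tight, hence a probability with
exponential tails. Irreducibility gives uniqueness, and Kac's argument for the
chain observed at multiples of a fixed time gives integrable return times. *)

(** * Countable decompositions *)

(** Within a run of consecutive positive differences the drift may vanish; only the leftmost
    difference of the run surely decreases. A sum of squares would therefore not feel a large
    difference sitting behind a small run start. In the product with the minimum it does: the
    minimum then equals the small start, and the negative drift of that start is multiplied by the
    large difference.

    The hypotheses on [X] give rates state by state, without uniformity in the starting point, and
    say nothing about expectations of unbounded functions. Hence [W] is never integrated against the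
    law of [X]: only Euler iterates, which are finite sums, are applied to it, and only indicators
    are carried over to the continuous semigroup.

    The columns of [X] grow forever, so no invariant probability exists on configurations. The
    stationary mean nevertheless lives there, where [gen] is explicit; it is only finitely additive,
    and becomes tight after composition with [Delta]. *)

Lemma measurable_countable_preimage d (T : measurableType d) (S : countType)
    (Y : T -> S) : (forall y, measurable [set w | Y w = y]) ->
  forall A : set S, measurable [set w | A (Y w)].
Proof.
move=> mY A; rewrite (_ : [set w | _] = \bigcup_(y : S)
    (if `[< A y >] then [set w | Y w = y] else set0)).
  by apply: countable_bigcupT_measurable => // y; case: ifP.
apply/seteqP; split=> w /=.
  by move=> Aw; exists (Y w) => //=; rewrite asboolT.
by move=> [y _]; case: asboolP => //= Ay ->.
Qed.

Lemma measurable_fun_countable d (T : measurableType d) d' (T' : measurableType d')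
    (S : countType) (E : set T) (Y : T -> S) (f : S -> T') :
  (forall y, measurable [set w | Y w = y]) ->
  measurable_fun E (fun w => f (Y w)).
Proof.
move=> mY mE B mB; apply: measurableI => //.
exact: (measurable_countable_preimage mY (fun y => B (f y))).
Qed.

Section CountableSums.
Context {R : realType} {S : countType}.
Implicit Types (f : S -> \bar R) (A : set S).
Local Open Scope ereal_scope.

(** Moves sums over a countable type to series over codes, where scaling, interchange and additivity
    over countable unions are at hand. A number that codes nothing contributes the default [0]. *)
Lemma esum_nneseries f : (forall y, 0 <= f y) ->
  \esum_(y in [set: S]) f y = \sum_(k <oo) oapp f 0 (pickle_inv k).
Proof.
move=> f0; set h := fun k => oapp f 0 (pickle_inv k).
have h0 k : 0 <= h k by rewrite /h; case: pickle_inv => /=.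
rewrite nneseries_esumT//.
transitivity (\esum_(k in range (@pickle S)) h k).
  rewrite (reindex_esum [set: S] _ (@pickle S)).
    by apply: eq_esum => y _; rewrite /h pickleK_inv.
  by apply: inj_bij => x y _ _; exact: (pcan_inj pickleK_inv).
rewrite esum_mkcond; apply: eq_esum => k _; case: ifPn => //; rewrite notin_setE => nk.
rewrite /h; case E: (pickle_inv k) => [y|]//=; exfalso; apply: nk.
by exists y => //; have := @pickle_invK S k; rewrite E.
Qed.

Lemma le_esum1 f y : (forall x, 0 <= f x) -> f y <= \esum_(x in [set: S]) f x.
Proof.
by move=> f0; apply: esum_ge; exists [set y]; [split|rewrite fsbig_set1].
Qed.

Lemma ge0_esumZl (a : \bar R) f : 0 <= a -> (forall y, 0 <= f y) ->
  \esum_(y in [set: S]) (a * f y) = a * \esum_(y in [set: S]) f y.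
Proof.
move=> a0 f0; have af0 y : 0 <= a * f y by rewrite mule_ge0.
have [/fineK aE|] := boolP (a \is a fin_num).
  rewrite -aE !esum_nneseries// => [|y]; last by rewrite aE.
  rewrite -nneseriesZl// => [|k _]; last by case: pickle_inv => /=.
  by apply: eq_eseriesr => k _; case: pickle_inv => //=; rewrite mule0.
rewrite ge0_fin_numE// -leNgt leye_eq => /eqP aE.
have [f00|] := pselect (forall y, f y = 0).
  by rewrite !esum1 ?mule0// => y _; rewrite f00 ?mule0.
move=> /existsNP[y /eqP fy]; have {}fy : 0 < f y by rewrite lt0e fy f0.
have := le_esum1 y af0; have := le_esum1 y f0.
rewrite aE gt0_mulye// leye_eq => fle /eqP ->.
by rewrite gt0_mulye// (lt_le_trans fy).
Qed.

Lemma ge0_integral_esum d (T : measurableType d) (mu : {measure set T -> \bar R})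
    (E : set T) (Y : T -> S) f :
  measurable E -> (forall y, measurable [set w | Y w = y]) ->
  (forall y, 0 <= f y) ->
  \int[mu]_(w in E) f (Y w) = \esum_(y in [set: S]) (f y * mu (E `&` [set w | Y w = y])).
Proof.
move=> mE mY f0.
rewrite esum_nneseries => [|y]; last by rewrite mule_ge0.
pose F k := E `&` [set w | pickle (Y w) = k].
have FE k : F k = if pickle_inv k is Some y then E `&` [set w | Y w = y] else set0.
  rewrite /F; case E1: (pickle_inv k) => [y|].
    have yk : pickle y = k by have := @pickle_invK S k; rewrite E1.
    congr (_ `&` _); apply/seteqP; split=> w /=.
      by rewrite -yk; exact: (pcan_inj pickleK_inv).
    by move=> ->.
  by apply/seteqP; split=> w //= -[_ wk]; move: E1; rewrite -wk pickleK_inv.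
have mF k : measurable (F k).
  by rewrite FE; case: pickle_inv => // y; exact: measurableI.
have UF : \bigcup_k F k = E.
  apply/seteqP; split=> [w [k _ []]//|w Ew]; by exists (pickle (Y w)).
have tF : trivIset setT F.
  by apply/trivIsetP => i j _ _ ij; apply/seteqP; split=> w //= [[_ wi] [_ wj]]; move: ij; rewrite -wi wj eqxx.
rewrite -{1}UF ge0_integral_bigcup//; last exact: measurable_fun_countable.
apply: eq_eseriesr => k _; rewrite FE; case: pickle_inv => [y|] /=; last by rewrite integral_set0.
rewrite (@eq_integral _ _ _ _ _ (cst (f y))); last by move=> w; rewrite inE => -[_ /= ->].
by rewrite integral_cst//; exact: measurableI.
Qed.

End CountableSums.

Lemma exchange_esum (R : realType) (S S' : countType) (a : S -> S' -> \bar R) :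
  (forall x y, (0 <= a x y)%E) ->
  (\esum_(x in [set: S]) \esum_(y in [set: S']) a x y =
   \esum_(y in [set: S']) \esum_(x in [set: S]) a x y)%E.
Proof.
move=> a0.
pose h k l := oapp (fun x => oapp (a x) 0%E (@pickle_inv S' l)) 0%E (@pickle_inv S k).
have h0 k l : (0 <= h k l)%E by rewrite /h; do 2 case: pickle_inv => //=.
rewrite esum_nneseries => [|x]; last exact: esum_ge0.
rewrite [RHS]esum_nneseries => [|x]; last exact: esum_ge0.
transitivity (\sum_(k <oo) \sum_(l <oo) h k l)%E.
  apply: eq_eseriesr => k _; rewrite /h; case: (@pickle_inv S k) => [x|] /=.
    by rewrite esum_nneseries.
  by rewrite eseries0.
rewrite nneseries_interchange//; apply: eq_eseriesr => l _; rewrite /h.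
case: (@pickle_inv S' l) => [y|] /=; first by rewrite esum_nneseries.
by rewrite eseries0// => k _; case: pickle_inv.
Qed.

Lemma measure_esum (R : realType) d (T : measurableType d) (S : countType)
    (mu : {measure set T -> \bar R}) (E : set T) (Y : T -> S) (A : set S) :
  measurable E -> (forall y, measurable [set w | Y w = y]) ->
  mu (E `&` [set w | A (Y w)]) =
  \esum_(y in [set: S]) ((\1_A y)%:E * mu (E `&` [set w | Y w = y]))%E.
Proof.
move=> mE mY; rewrite -(@ge0_integral_esum _ _ _ _ _ _ _ (fun y => (\1_A y)%:E))//.
rewrite setIC -integral_indic//; last exact: measurable_countable_preimage.
Qed.

(** * Lyapunov function *)

Section CrystalGenerator.
Context {R : realType} (b0 b1 b2 : R) {n : nat}.
Implicit Types (x : config n) (i j : 'I_n) (f g : config n -> R).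

Definition rate x i : R :=
  crystal_rate b0 b1 b2 (x (ord_pred i)) (x i) (x (ordS i)).

Definition gen f x : R := \sum_(i < n) rate x i * (f (grow x i) - f x).

Lemma gen_sum (I : finType) (F : I -> config n -> R) x :
  gen (fun y => \sum_(k : I) F k y) x = \sum_(k : I) gen (F k) x.
Proof.
rewrite /gen exchange_big; apply: eq_bigr => i _.
by rewrite -sumrB mulr_sumr.
Qed.

Lemma gen_scale (a : R) f x : gen (fun y => a * f y) x = a * gen f x.
Proof.
by rewrite /gen mulr_sumr; apply: eq_bigr => i _; rewrite -mulrBr mulrCA.
Qed.

Context (b0_gt0 : 0 < b0) (b01 : b0 < b1) (b12 : b1 < b2).

Lemma rate_bounds x i : b0 <= rate x i <= b2.
Proof.
by rewrite /rate /crystal_rate; case: ifP => _; [|case: ifP => _];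
  apply/andP; split; move: b01 b12; lra.
Qed.

Lemma rate_gt0 x i : 0 < rate x i.
Proof. have /andP[+ _] := rate_bounds x i; move: b0_gt0; lra. Qed.

Lemma rate_ge0 x i : 0 <= rate x i.
Proof. exact/ltW/rate_gt0. Qed.

Lemma rate_le x i : rate x i <= b2.
Proof. by have /andP[] := rate_bounds x i. Qed.

Lemma b2_gt0 : 0 < b2. Proof. move: b0_gt0 b01 b12; lra. Qed.

Lemma sum_rate_le x : \sum_(i < n) rate x i <= n%:R * b2.
Proof.
apply: (@le_trans _ _ (\sum_(i < n) b2)).
  by apply: ler_sum => i _; exact: rate_le.
by rewrite sumr_const card_ord mulr_natl.
Qed.

Lemma gen_bound (a : R) f x : (forall i, `|f (grow x i) - f x| <= a) ->
  `|gen f x| <= n%:R * b2 * a.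
Proof.
move=> fa; apply: le_trans (ler_norm_sum _ _ _) _.
apply: (@le_trans _ _ (\sum_(i < n) rate x i * a)).
  apply: ler_sum => i _; rewrite normrM ger0_norm ?rate_ge0//.
  by rewrite ler_wpM2l ?rate_ge0.
case: (posnP n) => [n0|n0].
  rewrite big1 => [|i _]; first by rewrite n0 !mul0r.
  by have := ltn_ord i; rewrite {2}n0.
have a0 : 0 <= a by apply: le_trans (fa (Ordinal n0)).
by rewrite -mulr_suml ler_wpM2r// sum_rate_le.
Qed.

(** Chain and product rules for the generator enter through this comparison: as [x] is fixed, [a]
    and [b] can be derivatives taken at [x], while [c] bounds the second-order part of a single
    jump. *)
Lemma gen_le_lin (a b c : R) f g h x : 0 <= c ->
  (forall i, f (grow x i) - f x <=
     a * (g (grow x i) - g x) + b * (h (grow x i) - h x) + c) ->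
  gen f x <= a * gen g x + b * gen h x + n%:R * b2 * c.
Proof.
move=> c0 fgh; apply: (@le_trans _ _ (a * gen g x + b * gen h x +
   (\sum_(i < n) rate x i) * c)); last first.
  by rewrite lerD2l ler_wpM2r// sum_rate_le.
rewrite /gen !mulr_sumr mulr_suml -!big_split/=; apply: ler_sum => i _.
have := ler_wpM2l (rate_ge0 x i) (fgh i); lra.
Qed.

End CrystalGenerator.

(** * Positive parts of the differences and the quadratic function *)

Section PositiveDifferences.
Context {R : realType} {n : nat} (n_ge2 : (2 <= n)%N).
Implicit Types (x : config n) (i j l : 'I_n).

(** Subtraction in [nat] truncates at zero, which makes this the positive part. *)
Definition pos_diff x j : nat := (x j - x (ordS j))%N.

Local Notation zp := pos_diff.

Lemma ordS_neq j : ordS j != j.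
Proof.
apply/eqP => /(congr1 val) /=; case: j => j /= jn.
have [jn'|jn'] := eqVneq j.+1 n; first by rewrite jn' modnn; lia.
by rewrite modn_small; lia.
Qed.

Lemma pos_diff_grow_self x j : zp (grow x j) j = ((x j).+1 - x (ordS j))%N.
Proof. by rewrite /zp !ffunE eqxx (negbTE (ordS_neq j)) addn0 addn1. Qed.

Lemma pos_diff_grow_next x j : zp (grow x (ordS j)) j = (zp x j).-1.
Proof.
rewrite /zp !ffunE eqxx eq_sym (negbTE (ordS_neq j)) addn0 addn1; lia.
Qed.

Lemma pos_diff_grow_other x i j : i != j -> i != ordS j ->
  zp (grow x i) j = zp x j.
Proof.
by move=> ij iSj; rewrite /zp !ffunE ![_ == i]eq_sym (negbTE ij) (negbTE iSj) !addn0.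
Qed.

Lemma pos_diff_lip x i j :
  (zp (grow x i) j <= (zp x j).+1)%N /\ (zp x j <= (zp (grow x i) j).+1)%N.
Proof.
have [->|ij] := eqVneq i j; first by rewrite pos_diff_grow_self /zp; lia.
have [->|iSj] := eqVneq i (ordS j); first by rewrite pos_diff_grow_next; lia.
by rewrite pos_diff_grow_other//; lia.
Qed.

Lemma iter_ordSK k : cancel (iter k (@ord_pred n)) (iter k (@ordS n)).
Proof.
by elim: k => // k IH j; rewrite iterSr /= ord_predK IH.
Qed.

Lemma iter_ord_pred_n j : iter n (@ord_pred n) j = j.
Proof.
have iterE k i : val (iter k (@ordS n) i) = ((i + k) %% n)%N.
  elim: k => [|k IH] /=; first by rewrite addn0 modn_small.
  by rewrite IH -[(_ %% _).+1]addn1 modnDml -addnA addn1.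
have itern i : iter n (@ordS n) i = i.
  by apply: val_inj; rewrite iterE modnDr modn_small.
by rewrite -[LHS]itern iter_ordSK.
Qed.

(** If no vanishing positive part were met on the way to the left, the heights would strictly
    increase along a full turn of the cycle and yet come back to [x j]. *)
Lemma run_startP x j : (0 < zp x j)%N ->
  exists k, [/\ (k < n)%N,
    forall k', (k' <= k)%N -> (0 < zp x (iter k' (@ord_pred n) j))%N &
    zp x (iter k.+1 (@ord_pred n) j) = 0%N].
Proof.
move=> zj.
have ex : exists k, (k < n)%N && (zp x (iter k.+1 (@ord_pred n) j) == 0%N).
  apply: contrapT => nex.
  have pos k : (k < n)%N -> (0 < zp x (iter k.+1 (@ord_pred n) j))%N.
    move=> kn; rewrite lt0n; apply/negP => z0; apply: nex.
    by exists k; rewrite kn.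
  have incr k : (k <= n)%N -> (x j + k <= x (iter k (@ord_pred n) j))%N.
    elim: k => [|k IH] kn; first by rewrite addn0.
    have := pos _ kn; have := IH (ltnW kn); rewrite /zp /= ord_predK; lia.
  have := incr n (leqnn n); rewrite iter_ord_pred_n; lia.
case: (ex_minnP ex) => k /andP[kn /eqP zk] kmin.
exists k; split=> // -[|k'] //= k'k; rewrite lt0n; apply/negP => z0.
have := kmin k'; rewrite (ltn_trans k'k kn) z0 => /(_ isT); lia.
Qed.

Definition total_drop x : R := \sum_(j < n) (zp x j)%:R.

Lemma pos_diff_le_total x j : (zp x j)%:R <= total_drop x.
Proof. by rewrite /total_drop (bigD1 j)//= lerDl sumr_ge0. Qed.

Lemma total_drop_ge0 x : 0 <= total_drop x.
Proof. exact: sumr_ge0. Qed.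

(** The differences sum to zero, so a negative one is balanced by the positive ones; controlling
    positive parts is enough. *)
Lemma diff_le_total x i :
  `|(x i)%:R - (x (ordS i))%:R| <= total_drop x :> R.
Proof.
pose d j : R := (x j)%:R - (x (ordS j))%:R.
have dz j : d j <= (zp x j)%:R.
  rewrite /d /zp lerBlDr -natrD ler_nat; lia.
have d0 : \sum_(j < n) d j = 0.
  rewrite /d sumrB; apply/eqP; rewrite subr_eq0; apply/eqP.
  by rewrite (reindex (@ordS n)) //; exact/onW_bij/ordS_bij.
rewrite ler_norml; apply/andP; split; last exact: le_trans (dz i) (pos_diff_le_total x i).
rewrite lerNl -/(d i); move: d0; rewrite (bigD1 i)//= addrC => /eqP.
rewrite addr_eq0 => /eqP <-; rewrite /total_drop [leRHS](bigD1 i)//=.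
by rewrite -[leLHS]add0r lerD// ler_sum.
Qed.

Definition pair_term x j l : R := (zp x j * minn (zp x j) (zp x l))%:R.

Lemma pair_term_le_sq x j l : 0 <= pair_term x j l <= (zp x j)%:R ^+ 2.
Proof.
by rewrite ler0n expr2 /pair_term -natrM ler_nat leq_mul2l geq_minl orbT.
Qed.

Lemma pair_term_lip x i j l :
  `|pair_term (grow x i) j l - pair_term x j l| <= 2 * (zp x j)%:R + 1.
Proof.
have [h1 h2] := pos_diff_lip x i j; have [h3 h4] := pos_diff_lip x i l.
rewrite /pair_term; move: h1 h2 h3 h4.
set a := zp x j; set a' := zp (grow x i) j.
set e := zp x l; set e' := zp (grow x i) l => h1 h2 h3 h4.
have m1 : (minn a' e' <= (minn a e).+1)%N by lia.
have m2 : (minn a e <= (minn a' e').+1)%N by lia.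
have m3 : (minn a e <= a)%N by lia.
have m4 : (minn a' e' <= a')%N by lia.
move: (minn a e) (minn a' e') m1 m2 m3 m4 => m m' m1 m2 m3 m4.
rewrite -(ler_nat R) -natr1 in h1; rewrite -(ler_nat R) -natr1 in h2.
rewrite -(ler_nat R) -natr1 in m1; rewrite -(ler_nat R) -natr1 in m2.
rewrite -(ler_nat R) in m3; rewrite -(ler_nat R) in m4.
have m0 : 0 <= m%:R :> R by []; have m0' : 0 <= m'%:R :> R by [].
rewrite !natrM ler_norml; apply/andP; split; nra.
Qed.

Context (eps : R) (eps_gt0 : 0 < eps) (eps_le1 : eps <= 1).

(* The neighbour at cyclic distance [k] to the left enters with weight [eps ^ k]
   because the drift of a difference is only controlled by the left end of the
   run of positive differences that contains it. *)
Definition lyap x : R :=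
  \sum_(j < n) \sum_(k < n) eps ^+ k * pair_term x j (iter k (@ord_pred n) j).

Lemma lyap_ge x j : (zp x j)%:R ^+ 2 <= lyap x.
Proof.
have t0 i (k : 'I_n) : 0 <= eps ^+ k * pair_term x i (iter k (@ord_pred n) i).
  by rewrite mulr_ge0 ?exprn_ge0 ?(ltW eps_gt0)//.
rewrite /lyap (bigD1 j)//= (bigD1 (Ordinal (ltnW n_ge2)))//= expr0 mul1r.
rewrite /= {1}/pair_term minnn natrM -expr2 -addrA lerDl addr_ge0 ?sumr_ge0//.
by move=> i _; rewrite sumr_ge0.
Qed.

Lemma lyap_le x : lyap x <= n%:R * total_drop x ^+ 2.
Proof.
rewrite expr2 {1}/total_drop mulr_suml mulr_sumr; apply: ler_sum => j _.
apply: (@le_trans _ _ (\sum_(k < n) (zp x j)%:R * total_drop x)); last first.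
  by rewrite sumr_const card_ord [leRHS]mulr_natl.
apply: ler_sum => k _.
have /andP[p0 p1] := pair_term_le_sq x j (iter k (@ord_pred n) j).
apply: le_trans (_ : pair_term x j (iter k (@ord_pred n) j) <= _).
  by rewrite ler_piMl// exprn_ile1// ltW.
by rewrite (le_trans p1)// expr2 ler_wpM2l ?pos_diff_le_total.
Qed.

Lemma lyap_lip x i :
  `|lyap (grow x i) - lyap x| <= n%:R * (n%:R * (2 * total_drop x + 1)).
Proof.
have cst (a : R) : \sum_(k < n) a = n%:R * a.
  by rewrite sumr_const card_ord mulr_natl.
rewrite /lyap -sumrB -cst; apply: le_trans (ler_norm_sum _ _ _) _.
apply: ler_sum => j _; rewrite -sumrB -cst.
apply: le_trans (ler_norm_sum _ _ _) _; apply: ler_sum => k _.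
have e0 : 0 <= eps ^+ k by rewrite exprn_ge0// ltW.
rewrite -mulrBr normrM ger0_norm//.
apply: (@le_trans _ _ (2 * (zp x j)%:R + 1)); last first.
  by rewrite lerD2r ler_wpM2l ?pos_diff_le_total.
apply: le_trans (pair_term_lip x i j (iter k (@ord_pred n) j)).
by rewrite ler_piMl// exprn_ile1// ltW.
Qed.

Lemma lyap_ge0 x : 0 <= lyap x.
Proof. exact: le_trans (sqr_ge0 _) (lyap_ge x (Ordinal (ltnW n_ge2))). Qed.

Definition sqrt_lyap x : R := Num.sqrt (1 + lyap x).

Lemma sqrt_lyap_sq x : sqrt_lyap x ^+ 2 = 1 + lyap x.
Proof. by rewrite sqr_sqrtr// addr_ge0// lyap_ge0. Qed.

Lemma sqrt_lyap_ge1 x : 1 <= sqrt_lyap x.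
Proof. by rewrite -sqrtr1 ler_wsqrtr// lerDl lyap_ge0. Qed.

Lemma total_drop_le x : total_drop x <= n%:R * sqrt_lyap x.
Proof.
rewrite -[n in leRHS]card_ord mulr_natl -sumr_const; apply: ler_sum => j _.
rewrite -(@ler_pXn2r _ 2)// ?nnegrE ?(le_trans _ (sqrt_lyap_ge1 x))//.
by rewrite sqrt_lyap_sq (le_trans (lyap_ge x j))// lerDr.
Qed.

Lemma sqrt_lyap_le x : sqrt_lyap x <= 1 + n%:R * total_drop x.
Proof.
have t0 := total_drop_ge0 x; have f1 := sqrt_lyap_ge1 x.
have n1 : 1 <= n%:R :> R by rewrite ler1n ltnW.
have nt0 : 0 <= n%:R * total_drop x by rewrite mulr_ge0.
rewrite -(@ler_pXn2r _ 2)// ?nnegrE ?(le_trans _ f1) ?addr_ge0//.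
rewrite sqrt_lyap_sq; have := lyap_le x.
have : n%:R * total_drop x ^+ 2 <= (n%:R * total_drop x) ^+ 2.
  by rewrite exprMn ler_wpM2r ?sqr_ge0// expr2 ler_peMl// (le_trans _ n1).
nra.
Qed.

(** The jumps of [lyap] are at most [n * (n * (2 * total_drop + 1))], where [total_drop] is at most
    [n * sqrt_lyap] and [1] is at most [sqrt_lyap]. Dividing this difference of squares by
    [sqrt_lyap] leaves the constant. *)
Definition lyap_jump : R := n%:R * (n%:R * (2 * n%:R + 1)).

Lemma sqrt_lyap_lip x i :
  `|sqrt_lyap (grow x i) - sqrt_lyap x| <= lyap_jump.
Proof.
have f1 := sqrt_lyap_ge1 x; have f1' := sqrt_lyap_ge1 (grow x i).
set f := sqrt_lyap x in f1 *; set f' := sqrt_lyap (grow x i) in f1' *.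
have f0 : 0 < f by exact: lt_le_trans f1.
have : `|f' - f| * (f' + f) <= lyap_jump * f.
  rewrite -[X in _ * X <= _]ger0_norm ?addr_ge0 ?(le_trans _ f1) ?(le_trans _ f1')//.
  rewrite -normrM -subr_sqr !sqrt_lyap_sq opprD addrACA subrr add0r; apply: le_trans (lyap_lip x i) _.
  rewrite /lyap_jump -!mulrA !ler_wpM2l//.
  by have := total_drop_le x; rewrite -/f mulrDl; lra.
have := normr_ge0 (f' - f); move: `|f' - f| => t t0 h.
rewrite -(ler_pM2r f0); nra.
Qed.

End PositiveDifferences.

(** * Drift of the quadratic function *)

Section LyapunovDrift.
Context {R : realType} (b0 b1 b2 : R) {n : nat}.
Context (b0_gt0 : 0 < b0) (b01 : b0 < b1) (b12 : b1 < b2) (n_ge2 : (2 <= n)%N).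
Implicit Types (x : config n) (i j l : 'I_n).
Local Notation rate := (@rate R b0 b1 b2 n).
Local Notation gen := (@gen R b0 b1 b2 n).
Local Notation zp := pos_diff.
Local Notation pair_term := (@pair_term R n).
Local Notation total_drop := (@total_drop R n).

Definition drift x j : R := gen (fun y => (zp y j)%:R) x.

(** Only a growth of column [j] can raise the difference at [j], by one and at rate at most [b2]. *)
Lemma drift_le x j : drift x j <= b2.
Proof.
rewrite /drift /gen (bigD1 j)//= (bigD1 (ordS j)) ?ordS_neq//=.
rewrite big1 => [|i /andP[ij iSj]]; last first.
  by rewrite pos_diff_grow_other// subrr mulr0.
have rj := rate_le b01 b12 x j.
have rj0 := rate_ge0 b0_gt0 b01 b12 x j.
have rS0 := rate_ge0 b0_gt0 b01 b12 x (ordS j).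
have h1 : (zp (grow x j) j)%:R - (zp x j)%:R <= 1 :> R.
  by rewrite lerBlDr addrC natr1 ler_nat; case: (pos_diff_lip n_ge2 x j j).
have h2 : (zp (grow x (ordS j)) j)%:R - (zp x j)%:R <= 0 :> R.
  by rewrite subr_le0 ler_nat pos_diff_grow_next ?leq_pred.
have := ler_wpM2l rj0 h1; have := ler_wpM2l rS0 h2; lra.
Qed.

Lemma drift_pos x j : (0 < zp x j)%N ->
  drift x j = rate x j - rate x (ordS j).
Proof.
move=> zj; rewrite /drift /gen (bigD1 j)//= (bigD1 (ordS j)) ?ordS_neq//=.
rewrite big1 => [|i /andP[ij iSj]]; last first.
  by rewrite pos_diff_grow_other// subrr mulr0.
have -> : zp (grow x j) j = (zp x j).+1.
  by move: zj; rewrite pos_diff_grow_self /zp; lia.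
have -> : (zp (grow x (ordS j)) j)%:R = (zp x j)%:R - 1 :> R.
  by rewrite pos_diff_grow_next// -[in RHS](prednK zj) -natr1 addrK.
by rewrite -natr1; ring.
Qed.

(** Column [j] is higher than its right neighbour, so its rate is at most [b1]; column [ordS j] is
    lower than its left neighbour, so its rate is at least [b1]. *)
Lemma drift_le0 x j : (0 < zp x j)%N -> drift x j <= 0.
Proof.
move=> zj; rewrite drift_pos// /rate /crystal_rate ordSK.
move: zj; rewrite /zp => zj.
have -> : (x j < minn (x (ord_pred j)) (x (ordS j)))%N = false by lia.
have -> : (x (ordS j) < maxn (x j) (x (ordS (ordS j))))%N by lia.
by clear zj; move: b01 b12; do 2 case: ifP => _; lra.
Qed.

(** Here column [j] is at least as high as both neighbours and grows at rate [b0], against at least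
    [b1] for column [ordS j]. *)
Lemma drift_run_start x j : (0 < zp x j)%N -> zp x (ord_pred j) = 0%N ->
  drift x j <= b0 - b1.
Proof.
move=> zj zpj; rewrite drift_pos// /rate /crystal_rate ordSK.
move: zj zpj; rewrite /zp ord_predK => zj zpj.
have -> : (x j < minn (x (ord_pred j)) (x (ordS j)))%N = false by lia.
have -> : (x j < maxn (x (ord_pred j)) (x (ordS j)))%N = false by lia.
have -> : (x (ordS j) < maxn (x j) (x (ordS (ordS j))))%N by lia.
by clear zj zpj; move: b01 b12; case: ifP => _; lra.
Qed.

(* A bound, up to the factor [pos_diff x j], for the drift of [pair_term x j l]:
   the minimum of two functions drifts at most like the smaller one. *)
Definition pair_drift x j l : R :=
  if (zp x j <= zp x l)%N then 2 * drift x j else drift x l.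

(** The minimum equals one of its two arguments at [x] and is at most the same argument after the
    jump. So the pair term is compared with a square if [zp x j] is the smaller one, and otherwise
    with the product of both positive parts; the part of the product rule that carries [drift x j]
    is then nonpositive and dropped. Second-order terms are at most [1] per jump. *)
Lemma gen_pair_term x j l :
  gen (pair_term^~ j ^~ l) x <= (zp x j)%:R * pair_drift x j l + n%:R * b2.
Proof.
rewrite -[n%:R * b2]mulr1 /pair_drift.
have [zj0|zj] := posnP (zp x j).
  apply: (@le_trans _ _ (0 * drift x j + 0 * drift x j + n%:R * b2 * 1)).
    apply: gen_le_lin => // i; rewrite !mul0r !add0r /pair_term zj0 mul0n subr0.
    rewrite lern1; case: (pos_diff_lip n_ge2 x i j); rewrite zj0.
    by move: (zp (grow x i) j) (zp (grow x i) l) => [|[|]]//=; lia.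
  by rewrite zj0 !mul0r !add0r.
case: leqP => zjl.
  apply: (@le_trans _ _ ((zp x j)%:R * 2 * drift x j + 0 * drift x j
      + n%:R * b2 * 1)); last by rewrite mul0r addr0 mulrA.
  apply: gen_le_lin => // i; rewrite mul0r addr0 /pair_term.
  rewrite (minn_idPl zjl).
  have [h1 h2] := pos_diff_lip n_ge2 x i j.
  set a := zp x j; set a' := zp (grow x i) j.
  apply: (@le_trans _ _ ((a' * a')%:R - (a * a)%:R)).
    by rewrite lerD2r ler_nat leq_mul2l geq_minl orbT.
  move: h1 h2; rewrite -/a -/a' !natrM -!(ler_nat R) -!natr1 => h1 h2; nra.
apply: (@le_trans _ _ ((zp x j)%:R * drift x l + (zp x l)%:R * drift x j
    + n%:R * b2 * 1)); last first.
  rewrite lerD2r gerDl; apply: mulr_ge0_le0 => //; exact: drift_le0.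
apply: gen_le_lin => // i; rewrite /pair_term (minn_idPr (ltnW zjl)).
have [h1 h2] := pos_diff_lip n_ge2 x i j; have [h3 h4] := pos_diff_lip n_ge2 x i l.
move: h1 h2 h3 h4.
set a := zp x j; set a' := zp (grow x i) j.
set c := zp x l; set c' := zp (grow x i) l => h1 h2 h3 h4.
apply: (@le_trans _ _ ((a' * c')%:R - (a * c)%:R)).
  by rewrite lerD2r ler_nat leq_mul2l geq_minr orbT.
move: h1 h2 h3 h4; rewrite !natrM -!(ler_nat R) -!natr1 => h1 h2 h3 h4.
have : (a'%:R - a%:R) * (c'%:R - c%:R) <= 1 :> R by nra.
lra.
Qed.

Context (eps : R) (eps_gt0 : 0 < eps) (eps_le1 : eps <= 1).
Local Notation lyap := (@lyap R n eps).
Local Notation sqrt_lyap := (@sqrt_lyap R n eps).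

Definition weighted_drift x j : R :=
  \sum_(k < n) eps ^+ k * pair_drift x j (iter k (@ord_pred n) j).

(** Inside the run all drifts are nonpositive, so the terms before [k0] are dropped. The terms after
    [k0] carry at least one more factor [eps] and are bounded through [drift_le]. *)
Lemma weighted_drift_le x j (k0 : nat) : (k0 < n)%N ->
  (forall k', (k' <= k0)%N -> (0 < zp x (iter k' (@ord_pred n) j))%N) ->
  weighted_drift x j <= eps ^+ k0 * pair_drift x j (iter k0 (@ord_pred n) j)
    + n%:R * b2 * eps ^+ k0.+1.
Proof.
move=> k0n pos; rewrite /weighted_drift (bigD1 (Ordinal k0n))//= lerD2l.
have zj : (0 < zp x j)%N by exact: (pos 0%N).
have b20 : 0 < b2 by exact: b2_gt0 b0_gt0 b01 b12.
have t0 : 0 <= b2 * eps ^+ k0.+1 by rewrite mulr_ge0 ?exprn_ge0// ltW.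
apply: (@le_trans _ _ (\sum_(k < n) b2 * eps ^+ k0.+1)); last first.
  by rewrite sumr_const card_ord -mulrA mulr_natl.
rewrite [leRHS](bigD1 (Ordinal k0n))//= -[leLHS]add0r lerD//.
apply: ler_sum => k kk0.
have dj := drift_le0 zj.
have D2 : pair_drift x j (iter k (@ord_pred n) j) <= b2.
  rewrite /pair_drift; case: ifP => _; last exact: drift_le.
  by apply: le_trans (ltW b20); rewrite mulr_ge0_le0.
have ek : 0 <= eps ^+ k by rewrite exprn_ge0// ltW.
case: (ltngtP k k0) => kk.
- apply: le_trans t0; apply: mulr_ge0_le0 => //.
  rewrite /pair_drift; case: ifP => _; first by rewrite mulr_ge0_le0.
  by apply: drift_le0; apply: pos; exact: ltnW.
- apply: (@le_trans _ _ (eps ^+ k * b2)); first by rewrite ler_wpM2l.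
  by rewrite mulrC ler_wpM2l ?(ltW b20)// ler_wiXn2l// ltW.
- by move/eqP: kk0; case; exact: val_inj.
Qed.

Lemma gen_lyap_le x :
  gen lyap x <= \sum_(j < n) (zp x j)%:R * weighted_drift x j
                + n%:R * (n%:R * (n%:R * b2)).
Proof.
have -> : gen lyap x = \sum_(j < n) \sum_(k < n)
    eps ^+ k * gen (pair_term^~ j ^~ (iter k (@ord_pred n) j)) x.
  rewrite (gen_sum b0 b1 b2
    (fun j y => \sum_(k < n) eps ^+ k * pair_term y j (iter k (@ord_pred n) j))).
  apply: eq_bigr => j _; rewrite (gen_sum b0 b1 b2
    (fun (k : 'I_n) y => eps ^+ k * pair_term y j (iter k (@ord_pred n) j))).
  by apply: eq_bigr => k _; rewrite gen_scale.
have b20 : 0 < b2 by exact: b2_gt0 b0_gt0 b01 b12.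
have cst (a : R) : \sum_(k < n) a = n%:R * a.
  by rewrite sumr_const card_ord mulr_natl.
rewrite -!cst -!big_split/=; apply: ler_sum => j _.
rewrite mulr_sumr -big_split/=; apply: ler_sum => k _.
apply: (@le_trans _ _ (eps ^+ k * ((zp x j)%:R *
  pair_drift x j (iter k (@ord_pred n) j) + n%:R * b2))).
  by rewrite ler_wpM2l ?exprn_ge0 ?gen_pair_term// ltW.
rewrite mulrDr mulrCA lerD2l cst ler_piMl ?mulr_ge0 ?(ltW b20)//.
by rewrite exprn_ile1// ltW.
Qed.

(** Concavity: the square root lies below its tangent at [1 + lyap x]. *)
Lemma gen_sqrt_lyap x :
  gen sqrt_lyap x <= (2 * sqrt_lyap x)^-1 * gen lyap x.
Proof.
have f1 := sqrt_lyap_ge1 n_ge2 eps_gt0 x; have f0 : 0 < sqrt_lyap x by exact: lt_le_trans f1.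
rewrite /gen mulr_sumr; apply: ler_sum => i _.
rewrite mulrCA ler_wpM2l ?rate_ge0// mulrC ler_pdivlMr ?mulr_gt0//.
have := sqr_ge0 (sqrt_lyap (grow x i) - sqrt_lyap x).
have := sqrt_lyap_sq n_ge2 eps_gt0 x; have := sqrt_lyap_sq n_ge2 eps_gt0 (grow x i).
move: (sqrt_lyap (grow x i)) (sqrt_lyap x) => u v; rewrite !expr2; nra.
Qed.

Local Notation c := (b1 - b0).
Context (eps_small : n%:R * (c / 2 * eps + n%:R * b2 * eps) <= c / 2).

(** [S0] collects the positive parts at the starts of runs, where the drift is at most [- c]. Every
    [j] may cost [kap * S0], and [eps_small] says that these [n] costs together are covered by the
    gain [c / 2 * S0] of the starts. *)
Lemma gen_lyap x : gen lyap x <=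
  n%:R * (n%:R * (n%:R * b2)) - c / 2 * eps ^+ n * total_drop x.
Proof.
have b20 : 0 < b2 by exact: b2_gt0 b0_gt0 b01 b12.
have c0 : 0 < c by rewrite subr_gt0.
apply: le_trans (gen_lyap_le x) _; rewrite addrC lerD2l.
pose start j := zp x (ord_pred j) == 0%N.
pose sigma j : R := if start j then (zp x j)%:R else 0.
pose S0 : R := \sum_(j < n) sigma j.
have sigma0 j : 0 <= sigma j by rewrite /sigma; case: ifP.
have S00 : 0 <= S0 by apply: sumr_ge0.
have S0ge j : start j -> (zp x j)%:R <= S0.
  move=> sj; rewrite /S0 (bigD1 j)//= {1}/sigma sj lerDl.
  by apply: sumr_ge0.
pose kap := c / 2 * eps + n%:R * b2 * eps.
have n1 : 1 <= n%:R :> R by rewrite ler1n ltnW.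
have nb0 : 0 <= n%:R * b2 * eps by rewrite !mulr_ge0// ltW.
have ce0 : 0 <= c / 2 * eps by rewrite !mulr_ge0// ltW.
have cen0 : 0 <= c / 2 * eps ^+ n by rewrite !mulr_ge0 ?exprn_ge0// ltW.
have kap0 : 0 <= kap by rewrite addr_ge0.
have enle : c / 2 * eps ^+ n <= c / 2 * eps.
  rewrite ler_wpM2l ?divr_ge0 ?(ltW c0)// -[leRHS]expr1.
  by rewrite ler_wiXn2l ?(ltW eps_gt0)// ltnW.
have nbe : n%:R * b2 * eps <= c / 2.
  by apply: le_trans eps_small; rewrite mulrDr; nra.
suff key j : (zp x j)%:R * weighted_drift x j + c / 2 * eps ^+ n * (zp x j)%:R
    <= - (c / 2) * sigma j + kap * S0.
  rewrite -subr_le0 opprK /total_drop mulr_sumr.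
  rewrite -big_split/=; apply: le_trans (ler_sum _ (fun j _ => key j)) _.
  rewrite big_split/= -mulr_sumr sumr_const card_ord -/S0 -mulr_natl.
  have := ler_wpM2r S00 eps_small; rewrite -/kap; lra.
have [zj|zj] := posnP (zp x j).
  by rewrite zj !mul0r mulr0 add0r /sigma zj if_same mulr0 add0r mulr_ge0.
have [k0 [k0n pos zk0]] := run_startP n_ge2 zj.
have wd := weighted_drift_le k0n pos.
set a : R := (zp x j)%:R; have a0 : 0 < a by rewrite /a ltr0n.
have ek0 : 0 <= eps ^+ k0 by rewrite exprn_ge0// ltW.
have [sj|nsj] := boolP (start j).
  have k00 : k0 = 0%N.
    case: (posnP k0) => // k0p; by have := pos 1%N k0p; move/eqP: sj => /= ->.
  rewrite /sigma sj -/a; move: wd; rewrite k00 expr0 mul1r expr1 /=.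
  rewrite {1}/pair_drift leqnn => wd.
  have dj : drift x j <= - c.
    by rewrite opprB; apply: drift_run_start => //; exact/eqP.
  have aS : a <= S0 by exact: S0ge.
  have w : weighted_drift x j <= - (c / 2) by lra.
  have := ler_wpM2l (ltW a0) w.
  have : c / 2 * eps ^+ n * a <= kap * S0.
    by apply: ler_pM => //; rewrite /kap; lra.
  lra.
rewrite /sigma (negbTE nsj) mulr0 add0r.
set s := iter k0 (@ord_pred n) j in wd.
have ss : start s by rewrite /start /s -iterS zk0.
(* [s] starts the run of [j]. If the difference at [s] is at least the one at [j], the possible loss
   is charged to [S0]. Otherwise the pair term has the drift of [s], at most [- c], with weight
   [eps ^+ k0], and half of this outweighs all terms beyond [s]. *)
have := wd; rewrite /pair_drift; case: leqP => zjs.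
  move=> _.
  have dj := drift_le0 zj.
  have aS : a <= S0 by apply: le_trans (S0ge s ss); rewrite ler_nat.
  have w : weighted_drift x j <= n%:R * b2 * eps.
    apply: le_trans wd _; rewrite /pair_drift zjs -[leRHS]add0r lerD//.
      by rewrite mulr_ge0_le0// mulr_ge0_le0.
    rewrite ler_wpM2l ?mulr_ge0 ?(ltW b20)// exprS ler_piMr ?(ltW eps_gt0)//.
    by rewrite exprn_ile1// ltW.
  have := ler_wpM2l (ltW a0) w.
  have h1 : a * (n%:R * b2 * eps) <= n%:R * b2 * eps * S0.
    by rewrite mulrC ler_wpM2l.
  have h2 : c / 2 * eps ^+ n * a <= c / 2 * eps * S0.
    by apply: ler_pM.
  rewrite /kap mulrDl; lra.
move=> wd'.
have ds : drift x s <= - c.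
  rewrite opprB; apply: drift_run_start; last exact/eqP.
  exact: pos.
have w : weighted_drift x j <= - (c / 2 * eps ^+ n).
  apply: le_trans wd' _.
  have e1 : eps ^+ k0 * drift x s <= eps ^+ k0 * - c by rewrite ler_wpM2l.
  have e2 : n%:R * b2 * eps ^+ k0.+1 <= c / 2 * eps ^+ k0.
    by rewrite exprS mulrA ler_wpM2r.
  have e3 : c / 2 * eps ^+ n <= c / 2 * eps ^+ k0.
    by rewrite ler_wpM2l ?divr_ge0 ?(ltW c0)// ler_wiXn2l ?(ltW eps_gt0)// ltnW.
  lra.
have := ler_wpM2l (ltW a0) w.
have : 0 <= kap * S0 by rewrite mulr_ge0.
lra.
Qed.

End LyapunovDrift.

(** * Exponential Lyapunov function *)

Section ExponentialLyapunov.
Context {R : realType} (b0 b1 b2 : R) {n : nat}.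
Context (b0_gt0 : 0 < b0) (b01 : b0 < b1) (b12 : b1 < b2) (n_ge2 : (2 <= n)%N).
Local Notation gen := (@gen R b0 b1 b2 n).

(** From [1 - y <= expR (- y)] the exponential is at most the inverse of [1 - y], which is below the
    quadratic on this range. *)
Lemma expR_le_quadratic (y : R) : `|y| <= 2^-1 -> expR y <= 1 + y + 2 * y ^+ 2.
Proof.
rewrite ler_norml => /andP[y0 y1].
have y1' : 0 < 1 - y by lra.
have h := expR_ge1Dx (- y).
have e0 := expR_gt0 y.
have : expR y * (1 - y) <= 1.
  apply: (@le_trans _ _ (expR y * expR (- y))); first by rewrite ler_wpM2l// ltW.
  by rewrite expRN divff// gt_eqF.
rewrite -ler_pdivlMr// => /le_trans; apply; rewrite ler_pdivrMr// expr2; nra.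
Qed.

(** With bounded jumps, a constant negative drift above level [K] becomes proportional to the value
    after exponentiation: the first-order term in [d] beats the second-order one for small [d]. *)
Lemma exp_drift (f : config n -> R) (J K k : R) : 0 < J -> 0 < k ->
  (forall x i, `|f (grow x i) - f x| <= J) ->
  (forall x, K < f x -> gen f x <= - k) ->
  exists d a G : R, [/\ 0 < d, 0 < a &
    forall x, gen (fun y => expR (d * f y)) x <= G - a * expR (d * f x)].
Proof.
move=> J0 k0 fJ fK.
have b20 : 0 < b2 by exact: b2_gt0 b0_gt0 b01 b12.
pose B := n%:R * b2; have B0 : 0 < B by rewrite mulr_gt0// ltr0n ltnW.
have BJ0 : 0 < B * J ^+ 2 by rewrite mulr_gt0// exprn_gt0.
have Jk0 : 0 < J * k by rewrite mulr_gt0.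
have den0 : 0 < 4 * B * J ^+ 2 + 2 * J * k by lra.
(* The two summands of the denominator give [2 * d * (B * J ^+ 2) <= k / 2], so that the quadratic
   error eats at most half of the drift, and [d * J <= 2^-1], the range of [expR_le_quadratic]. *)
pose d := k / (4 * B * J ^+ 2 + 2 * J * k).
have d0 : 0 < d by rewrite divr_gt0.
have dE : d * (4 * B * J ^+ 2 + 2 * J * k) = k.
  by rewrite mulrAC -mulrA divff ?mulr1// gt_eqF.
have dJ : d * J <= 2^-1.
  have h : d * (2 * J * k) <= k by rewrite -[leRHS]dE ler_wpM2l ?(ltW d0)//; lra.
  by rewrite -(ler_pM2r k0); lra.
have dB : 2 * d * (B * J ^+ 2) <= k / 2.
  have : d * (4 * (B * J ^+ 2)) <= k.
    by rewrite -[leRHS]dE ler_wpM2l ?(ltW d0)//; lra.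
  lra.
(* From below level [K] a jump leads at most to level [K + J], at total rate at most [B]: the first
   summand of the last witness bounds the generator there, the second makes up for the subtracted
   multiple of the function. *)
exists d, (d * k / 2), (expR (d * (K + J)) * B + d * k / 2 * expR (d * K)).
split=> //; first by rewrite !mulr_gt0// invr_gt0.
move=> x; have [fxK|fxK] := ltP K (f x).
- set w := expR (d * f x); have w0 : 0 < w := expR_gt0 _.
  have : gen (fun y => expR (d * f y)) x <=
      (w * d) * gen f x + 0 * gen f x + n%:R * b2 * (w * (2 * (d * J) ^+ 2)).
    apply: gen_le_lin => //.
      by apply: mulr_ge0; [exact: ltW|rewrite mulr_ge0 ?sqr_ge0].
    move=> i; rewrite mul0r addr0 -/w.
    have fi := fJ x i; set t := f (grow x i) - f x in fi *.
    have -> : expR (d * f (grow x i)) = w * expR (d * t).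
      by rewrite /w -expRD /t; congr expR; ring.
    have dt : `|d * t| <= d * J by rewrite normrM gtr0_norm// ler_pM2l.
    have := expR_le_quadratic (le_trans dt dJ).
    have : (d * t) ^+ 2 <= (d * J) ^+ 2.
      by rewrite -[leLHS]real_normK ?num_real// !expr2 ler_pM.
    move=> h1 h2; have : w * expR (d * t) <= w * (1 + d * t + 2 * (d * J) ^+ 2).
      by rewrite ler_pM2l//; lra.
    lra.
  have h1 := ler_wpM2l (ltW (mulr_gt0 w0 d0)) (fK x fxK).
  have h2 := ler_wpM2l (ltW (mulr_gt0 w0 d0)) dB.
  have h3 : 0 < expR (d * (K + J)) * B by rewrite mulr_gt0// expR_gt0.
  have h4 : 0 < d * k / 2 * expR (d * K) by rewrite !mulr_gt0// ?expR_gt0// invr_gt0.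
  rewrite mul0r addr0 -/B => h5; apply: (le_trans h5); rewrite !expr2 in h2 *; lra.
- have : gen (fun y => expR (d * f y)) x <=
      0 * gen f x + 0 * gen f x + n%:R * b2 * expR (d * (K + J)).
    apply: gen_le_lin => //.
    move=> i; rewrite !mul0r !add0r lerBlDr -[leLHS]addr0 lerD ?expR_ge0//.
    rewrite ler_expR ler_pM2l//; have := fJ x i; rewrite ler_norml; lra.
  rewrite !mul0r !add0r -/B.
  have : d * k / 2 * expR (d * f x) <= d * k / 2 * expR (d * K).
    by rewrite ler_pM2l ?mulr_gt0// ?invr_gt0// ler_expR ler_pM2l.
  lra.
Qed.

Lemma exists_exp_lyapunov : exists (W : config n -> R) (a G s : R),
  [/\ 0 < a, 0 < s, forall x, gen W x <= G - a * W x &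
    forall (x : config n) i, expR (s * `|(x i)%:R - (x (ordS i))%:R|) <= W x].
Proof.
pose c := b1 - b0; have c0 : 0 < c by rewrite subr_gt0.
have b20 : 0 < b2 by exact: b2_gt0 b0_gt0 b01 b12.
have n1 : 1 <= n%:R :> R by rewrite ler1n ltnW.
have n0 : 0 < n%:R :> R by exact: lt_le_trans n1.
have nb0 : 0 < n%:R * b2 by rewrite mulr_gt0.
have den0 : 0 < n%:R * (c + 2 * (n%:R * b2)).
  by rewrite mulr_gt0// addr_gt0// mulr_gt0.
(* The value for which [eps_small] is an equality. *)
pose eps := c / (n%:R * (c + 2 * (n%:R * b2))).
have eps0 : 0 < eps by rewrite divr_gt0.
have epsE : eps * (n%:R * (c + 2 * (n%:R * b2))) = c.
  by rewrite mulrAC -mulrA divff ?mulr1// gt_eqF.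
have eps1 : eps <= 1.
  by rewrite ler_pdivrMr// mul1r; nra.
have eps_small : n%:R * (c / 2 * eps + n%:R * b2 * eps) <= c / 2 by nra.
pose c' := c / 2 * eps ^+ n.
have c'0 : 0 < c' by rewrite !mulr_gt0// ?invr_gt0// exprn_gt0.
pose C := n%:R * (n%:R * (n%:R * b2)).
have C0 : 0 < C by rewrite /C !mulr_gt0.
have gl (x : config n) : gen (lyap eps) x <= C - c' * total_drop x.
  exact: (gen_lyap b0_gt0 b01 b12 n_ge2 eps0 eps1 eps_small).
(* Let [A] be [total_drop x]. Once [A0 < A], which the level [1 + n * A0] of [sqrt_lyap] guarantees,
   the bound [C - c' * A] is at most [- (c' / 2) * A]. Dividing by [2 * sqrt_lyap], itself at most
   [2 * (1 + n) * A], leaves [- k]. *)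
pose k := c' / (4 * (1 + n%:R)).
have k0 : 0 < k by rewrite divr_gt0// mulr_gt0// addr_gt0.
pose A0 := 1 + 2 * C / c'.
have A0c : c' * A0 = c' + 2 * C.
  by rewrite /A0 mulrDr mulr1 mulrCA divff ?mulr1// gt_eqF.
have J0 : 0 < @lyap_jump R n by rewrite !mulr_gt0// addr_gt0// mulr_gt0.
have fJ (x : config n) i : `|sqrt_lyap eps (grow x i) - sqrt_lyap eps x| <= @lyap_jump R n.
  exact: (sqrt_lyap_lip n_ge2 eps0 eps1).
have fK (x : config n) : 1 + n%:R * A0 < sqrt_lyap eps x -> gen (sqrt_lyap eps) x <= - k.
  move=> h.
  have fle := sqrt_lyap_le n_ge2 eps0 eps1 x.
  have f1 := sqrt_lyap_ge1 n_ge2 eps0 x.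
  set f := sqrt_lyap eps x in h fle f1 *; set A := total_drop x in fle.
  have AA : A0 < A by rewrite -(ltr_pM2l n0); lra.
  apply: le_trans (gen_sqrt_lyap b0_gt0 b01 b12 n_ge2 eps0 x) _.
  rewrite -/f mulrC ler_pdivrMr; last by lra.
  apply: le_trans (gl x) _; rewrite -/A.
  have A1 : 1 < A.
    by have q := divr_gt0 C0 c'0; rewrite /A0 in AA; lra.
  have h1 : c' * A0 < c' * A by rewrite ltr_pM2l.
  have h2 : k * (2 * f) <= k * (2 * ((1 + n%:R) * A)).
    rewrite ler_pM2l// ler_pM2l//; apply: le_trans fle _; lra.
  have h3 : k * (2 * ((1 + n%:R) * A)) = c' / 2 * A.
    rewrite /k; field; rewrite gt_eqF// addr_gt0//.
  lra.
have [d [a [G [d0 a0 gW]]]] := exp_drift J0 k0 fJ fK.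
(* The division by [n] comes from [total_drop_le]: every difference is at most [n * sqrt_lyap]. *)
exists (fun y => expR (d * sqrt_lyap eps y)), a, G, (d / n%:R).
split=> //; first exact: divr_gt0.
move=> x i; rewrite ler_expR -mulrA ler_pM2l// ler_pdivrMl//.
apply: le_trans (diff_le_total n_ge2 x i) _.
exact: total_drop_le.
Qed.

End ExponentialLyapunov.

(** * Transition probabilities *)

(* First-order errors that are locally [o(h)] cannot accumulate over a
   subdivision of [[a, a + T]] into [N] equal steps. *)
Lemma euler_estimate (R : realType) (g D th : R -> R) (m e a T : R) :
  0 <= a -> 0 < T ->
  (forall s h, 0 <= s -> 0 < h -> `|g (s + h) - g s - h * D s| <= th h) ->
  th h / h @[h --> 0^'+] --> 0 ->
  (forall s, a <= s <= a + T -> `|D s - e| <= m) ->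
  `|g (a + T) - g a - T * e| <= T * m.
Proof.
move=> a0 T0 gD th0 De; apply/ler_addgt0Pr => eps eps0.
have /cvgrPdist_lt/(_ (eps / T) (divr_gt0 eps0 T0)) := th0.
rewrite near_withinE => -[dl /= dl0 Hdl].
pose N := Num.bound (T / dl); pose h := T / N.+1%:R.
have N0 : 0 < N.+1%:R :> R by rewrite ltr0n.
have h0 : 0 < h by rewrite divr_gt0.
have hdl : h < dl.
  rewrite ltr_pdivrMr// -ltr_pdivrMl// mulrC.
  have := archi_boundP (ltW (divr_gt0 T0 dl0)).
  by move=> /lt_le_trans; apply; rewrite ler_nat.
have thh : th h <= h * (eps / T).
  have := Hdl h; rewrite /= sub0r normrN gtr0_norm// => /(_ hdl h0).
  rewrite sub0r normrN => H; rewrite mulrC -ler_pdivrMr//.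
  exact: le_trans (ler_norm _) (ltW H).
have step k : (k <= N.+1)%N ->
    `|g (a + k%:R * h) - g a - k%:R * h * e| <= k%:R * (h * m + h * (eps / T)).
  elim: k => [|k IH] kN; first by rewrite !mul0r addr0 !subrr normr0.
  have kh0 : 0 <= k%:R * h by rewrite mulr_ge0// ltW.
  have := IH (ltnW kN); set s := a + k%:R * h => IHk.
  have s0 : 0 <= s by rewrite addr_ge0.
  have := gD s h s0 h0.
  have -> : s + h = a + k.+1%:R * h by rewrite /s -natr1; ring.
  have sT : a <= s <= a + T.
    rewrite lerDl kh0/= lerD2l mulrCA ler_piMr ?(ltW T0)// ler_pdivrMr// mul1r.
    by rewrite ler_nat ltnW.
  have := De s sT; rewrite !ler_norml => /andP[d1 d2] /andP[g1 g2].
  have hd1 := ler_wpM2l (ltW h0) d1; have hd2 := ler_wpM2l (ltW h0) d2.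
  move: IHk; rewrite ler_norml => /andP[k1 k2].
  rewrite -natr1 in g1 g2 *; apply/andP; split; lra.
have := step N.+1 (leqnn _).
have NT : N.+1%:R * h = T by rewrite mulrCA divff ?mulr1// gt_eqF.
have -> : N.+1%:R * (h * m + h * (eps / T)) = T * m + eps.
  by rewrite -mulrDr mulrA NT mulrDr [T * (eps / T)]mulrC divfK// gt_eqF.
by rewrite NT.
Qed.

Section Neighbours.
Context {n : nat}.
Implicit Types (x : config n) (i : 'I_n).

(** Index [ord0] stands for not moving. These [n.+1] distinct configurations carry the law at time
    [h] up to [o(h)]. *)
Definition neighbour x (o : 'I_n.+1) : config n :=
  if unlift ord0 o is Some i then grow x i else x.

Lemma neighbour0 x : neighbour x ord0 = x.
Proof. by rewrite /neighbour unlift_none. Qed.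

Lemma neighbour_lift x i : neighbour x (lift ord0 i) = grow x i.
Proof. by rewrite /neighbour liftK. Qed.

Lemma grow_neq x i : grow x i != x.
Proof.
apply/eqP => /ffunP /(_ i); rewrite ffunE eqxx addn1 => /eqP.
by rewrite -[X in _ == X]addn0 -addn1 eqn_add2l.
Qed.

Lemma grow_inj x : injective (grow x).
Proof.
move=> i j /ffunP /(_ i); rewrite !ffunE eqxx => /eqP; rewrite eqn_add2l.
by case: (i =P j).
Qed.

Lemma neighbour_inj x : injective (neighbour x).
Proof.
move=> o o'; rewrite /neighbour.
case: unliftP => [i ->|->]; case: unliftP => [j ->|->] //.
- by move/grow_inj => ->.
- by move/eqP; rewrite (negbTE (grow_neq x i)).
- by move/esym/eqP; rewrite (negbTE (grow_neq x j)).
Qed.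

Lemma sum_neighbour (R : realType) x o (f : config n -> R) :
  \sum_(o' < n.+1) (neighbour x o == neighbour x o')%:R * f (neighbour x o') =
  f (neighbour x o).
Proof.
rewrite (bigD1 o)//= eqxx mul1r big1 ?addr0// => o' oo'.
by rewrite (inj_eq (@neighbour_inj x)) eq_sym (negbTE oo') mul0r.
Qed.

Lemma Delta_eq x y i : Delta x = Delta y ->
  (x i)%:Z - (x (ordS i))%:Z = (y i)%:Z - (y (ordS i))%:Z.
Proof. by move/(congr1 val)/ffunP/(_ i); rewrite !ffunE. Qed.

Lemma grow_Delta x y i : Delta x = Delta y -> Delta (grow x i) = Delta (grow y i).
Proof.
move=> xy; apply: val_inj; apply/ffunP => j; rewrite !ffunE.
have := Delta_eq j xy; rewrite !PoszD; lia.
Qed.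

End Neighbours.

Section Semigroup.
Context {R : realType} (b0 b1 b2 : R) {n : nat}.
Context (b0_gt0 : 0 < b0) (b01 : b0 < b1) (b12 : b1 < b2) (n_gt0 : (0 < n)%N).
Context {d : measure_display} {Omega : measurableType d}
  (P : config n -> probability Omega R) (X : R -> Omega -> config n)
  (XP : crystal_growth_process b0 b1 b2 P X).
Implicit Types (x y : config n) (A : set (config n)) (s t h : R).
Local Notation gen := (@gen R b0 b1 b2 n).

Lemma process_measurable t A : 0 <= t -> measurable [set w | A (X t w)].
Proof.
move=> t0; apply: measurable_countable_preimage => y.
exact: (mjp_measurable XP).
Qed.

Definition trans t x A : R := fine (P x [set w | A (X t w)]).

Lemma transE t x A : 0 <= t -> (trans t x A)%:E = P x [set w | A (X t w)].
Proof.
by move=> t0; rewrite fineK// fin_num_measure//; exact: process_measurable.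
Qed.

Lemma trans_ge0 t x A : 0 <= trans t x A.
Proof. exact: fine_ge0. Qed.

Lemma trans_le1 t x A : 0 <= t -> trans t x A <= 1.
Proof.
by move=> t0; rewrite -lee_fin transE// probability_le1//; exact: process_measurable.
Qed.

Lemma transC t x A : 0 <= t -> trans t x (~` A) = 1 - trans t x A.
Proof.
move=> t0; apply: EFin_inj; rewrite EFinB !transE// -probability_setC//.
exact: process_measurable.
Qed.

Lemma trans0 x A : trans 0 x A = \1_A x.
Proof.
have S1 := mjp_start XP x.
have aux B : B x -> trans 0 x B = 1.
  move=> Bx; apply/eqP; rewrite eq_le trans_le1//= -lee_fin transE// -S1.
  apply: le_measure; rewrite ?inE; [exact: (mjp_measurable XP)|exact: process_measurable|].
  by move=> w /= ->.
have [Ax|Ax] := pselect (A x); first by rewrite aux// indicE mem_set.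
have := aux (~` A) Ax; rewrite transC// indicE memNset// => /eqP.
by rewrite subr_eq addrC -subr_eq subrr => /eqP.
Qed.

Lemma past_measurable s : past X s `<=` measurable.
Proof.
apply: smallest_sub; first exact: sigma_algebra_measurable.
move=> _ [t [y [/andP[t0 _] ->]]]; exact: (mjp_measurable XP).
Qed.

Lemma past_setT s : past X s setT.
Proof.
move=> B [[B0 BC _] _]; rewrite -(setD0 setT); exact: BC.
Qed.

Lemma markov_set x s t y A E : 0 <= s -> 0 <= t -> past X s E ->
  P x (E `&` [set w | X s w = y] `&` [set w | A (X (s + t) w)]) =
  (P x (E `&` [set w | X s w = y]) * (trans t y A)%:E)%E.
Proof.
move=> s0 t0 pE.
have mE : measurable (E `&` [set w | X s w = y]).
  by apply: measurableI; [exact: past_measurable pE|exact: (mjp_measurable XP)].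
have st0 : 0 <= s + t by rewrite addr_ge0.
rewrite (measure_esum _ _ mE); last by move=> z; exact: (mjp_measurable XP).
rewrite transE// -[X in P y X]setTI (measure_esum _ _ measurableT); last first.
  by move=> z; exact: (mjp_measurable XP).
rewrite -ge0_esumZl//.
apply: eq_esum => z _; rewrite setTI.
rewrite [RHS]muleCA; congr (_ * _)%E; exact: (mjp_markov XP).
Qed.

(* Conditioning on being at distance at most one at time [h]. *)
Lemma trans_ge_neighbour x s h A : 0 <= s -> 0 <= h ->
  \sum_(o < n.+1) trans h x [set neighbour x o] * trans s (neighbour x o) A
  <= trans (h + s) x A.
Proof.
move=> s0 h0; have hs0 : 0 <= h + s by rewrite addr_ge0.
pose F (o : 'I_n.+1) := [set w | X h w = neighbour x o] `&` [set w | A (X (h + s) w)].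
have mF o : measurable (F o).
  by apply: measurableI; [exact: (mjp_measurable XP)|exact: process_measurable].
rewrite -lee_fin -sumEFin transE//.
rewrite (eq_bigr (fun o => P x (F o))) => [|o _]; last first.
  rewrite EFinM transE// -[in RHS]/(F o) /F -[X in _ = P x (X `&` _)]setTI.
  by rewrite markov_set ?setTI//; exact: past_setT.
rewrite -measure_bigsetU_ord//; last first.
  apply/trivIsetP => o o' _ _ oo'; apply/seteqP; split=> w //= [[wo _] [wo' _]].
  by move/eqP: oo'; apply; apply: (@neighbour_inj _ x); rewrite -wo -wo'.
apply: le_measure; rewrite ?inE; [exact: bigsetU_measurable|exact: process_measurable|].
by apply: (big_ind (fun S => S `<=` _)) => [w //|S1 S2 h1 h2 w [/h1|/h2]//|o _ w []].
Qed.

Lemma generator_neighbour x (f : config n -> R) :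
  \sum_(o < n.+1) crystal_generator b0 b1 b2 x (neighbour x o) * f (neighbour x o)
  = gen f x.
Proof.
under eq_bigr do rewrite mulr_suml.
rewrite exchange_big /gen; apply: eq_bigr => i _.
under eq_bigr do rewrite -mulrA.
rewrite -mulr_sumr /rate; congr (_ * _).
under eq_bigr do rewrite mulrBl.
rewrite sumrB; congr (_ - _).
  by rewrite -(neighbour_lift x i) sum_neighbour.
by rewrite -[in RHS](neighbour0 x) -(sum_neighbour x ord0) neighbour0.
Qed.

Lemma generator_sum0 x :
  \sum_(o < n.+1) crystal_generator b0 b1 b2 x (neighbour x o) = 0.
Proof.
transitivity (gen (cst 1) x); last first.
  by rewrite /gen big1// => i _; rewrite subrr mulr0.
by rewrite -generator_neighbour; apply: eq_bigr => o _; rewrite mulr1.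
Qed.

(** The error [th] depends on [x] but neither on [A] nor on [s]. Restricting to the neighbours at
    time [h] bounds [trans] from below only; the same bound for the complement of [A] supplies the
    upper one. The generator sums to zero over the neighbours, so the mass outside them is
    controlled by the same finite sum of errors. *)
Lemma trans_local_error x : exists th : R -> R,
  (forall A s h, 0 <= s -> 0 < h ->
    `|trans (s + h) x A - trans s x A - h * gen (fun y => trans s y A) x| <= th h) /\
  th h / h @[h --> 0^'+] --> 0.
Proof.
pose Q o := crystal_generator b0 b1 b2 x (neighbour x o).
pose dq o h := (trans h x [set neighbour x o] - (x == neighbour x o)%:R) / h.
exists (fun h => h * \sum_(o < n.+1) `|dq o h - Q o|); split; last first.
  have : \sum_(o < n.+1) `|dq o h - Q o| @[h --> 0^'+] --> \sum_(o < n.+1) (0 : R).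
    apply: cvg_big => [|o _]; first exact: add_continuous.
    have E0 : `|Q o - Q o| = 0 by rewrite subrr normr0.
    rewrite -[X in _ --> X]E0.
    by apply: cvg_norm; apply: cvgB; [exact: (mjp_rates XP)|exact: cvg_cst].
  rewrite sumr_const mul0rn; apply: cvg_trans; apply: near_eq_cvg.
  near=> h; have h0 : 0 < h by near: h; exact: nbhs_right_gt.
  by rewrite /= mulrAC divff ?mul1r// gt_eqF.
move=> A s h s0 h0; have h0' := ltW h0.
have sh0 : 0 <= s + h by rewrite addr_ge0.
set u := fun y => trans s y A.
pose e o := trans h x [set neighbour x o] - (x == neighbour x o)%:R - h * Q o.
have eE o : `|e o| = h * `|dq o h - Q o|.
  rewrite -[X in X * _]gtr0_norm// -normrM; congr (`|_|).
  by rewrite mulrBr /dq mulrCA divff ?mulr1// gt_eqF.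
have -> : h * \sum_(o < n.+1) `|dq o h - Q o| = \sum_(o < n.+1) `|e o|.
  by rewrite mulr_sumr; apply: eq_bigr => o _; rewrite eE.
have pE o : trans h x [set neighbour x o] = e o + ((x == neighbour x o)%:R + h * Q o).
  by rewrite /e; ring.
have one : \sum_(o < n.+1) ((x == neighbour x o)%:R + h * Q o) = 1.
  rewrite big_split/= -mulr_sumr generator_sum0 mulr0 addr0.
  have := sum_neighbour x ord0 (cst (1 : R)); rewrite neighbour0 => S1.
  by rewrite -[RHS]S1; apply: eq_bigr => o _; rewrite mulr1.
have lin : \sum_(o < n.+1) ((x == neighbour x o)%:R + h * Q o) * u (neighbour x o)
    = trans s x A + h * gen u x.
  under eq_bigr do rewrite mulrDl -mulrA.
  rewrite big_split/= -mulr_sumr generator_neighbour; congr (_ + _).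
  by have := sum_neighbour x ord0 u; rewrite neighbour0.
have lb := trans_ge_neighbour x A s0 h0'.
have ub := trans_ge_neighbour x (~` A) s0 h0'.
move: lb ub; rewrite [h + s]addrC transC//.
under eq_bigr do rewrite pE mulrDl.
rewrite big_split/= lin => lb.
under eq_bigr do rewrite transC// mulrBr mulr1.
rewrite sumrB; under [X in _ - X]eq_bigr do rewrite pE mulrDl.
rewrite [X in _ - X]big_split/= lin.
under eq_bigr do rewrite pE.
rewrite big_split/= one => ub.
have u1 o : 0 <= u (neighbour x o) <= 1 by rewrite trans_ge0 trans_le1.
have B1 : - \sum_(o < n.+1) `|e o| <= \sum_(o < n.+1) e o * u (neighbour x o).
  rewrite -sumrN; apply: ler_sum => o _; have /andP[v0 v1] := u1 o.
  have := ler_norm (- e o); rewrite normrN; have := normr_ge0 (e o); nra.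
have B2 : \sum_(o < n.+1) e o * u (neighbour x o) - \sum_(o < n.+1) e o
    <= \sum_(o < n.+1) `|e o|.
  rewrite -sumrB; apply: ler_sum => o _; have /andP[v0 v1] := u1 o.
  have := ler_norm (- e o); rewrite normrN; have := normr_ge0 (e o); nra.
rewrite ler_norml; apply/andP; split; lra.
Unshelve. all: by end_near.
Qed.

Local Notation B := (n%:R * b2).

Lemma B_gt0 : 0 < B.
Proof. by rewrite mulr_gt0 ?ltr0n//; exact: b2_gt0 b0_gt0 b01 b12. Qed.

Lemma gen_trans_le x A s : 0 <= s -> `|gen (fun y => trans s y A) x| <= B.
Proof.
move=> s0; rewrite -[leRHS]mulr1; apply: gen_bound => // i.
have := trans_ge0 s x A; have := trans_le1 x A s0.
have := trans_ge0 s (grow x i) A; have := trans_le1 (grow x i) A s0.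
by rewrite ler_norml => *; apply/andP; split; lra.
Qed.

Lemma trans_lipschitz x A s h : 0 <= s -> 0 <= h ->
  `|trans (s + h) x A - trans s x A| <= B * h.
Proof.
move=> s0; rewrite le_eqVlt => /predU1P[<-|h0].
  by rewrite addr0 subrr normr0 mulr0.
have [th [th1 th2]] := trans_local_error x.
rewrite -[X in `|X|]subr0 -(mulr0 h) [B * h]mulrC.
apply: (@euler_estimate R (fun t => trans t x A)
  (fun t => gen (fun y => trans t y A) x) th B 0 s h s0 h0 (th1 A) th2).
move=> t /andP[st _]; rewrite subr0.
by apply: gen_trans_le; exact: le_trans st.
Qed.

(** By the Lipschitz bound the slope varies by at most [B * (2 * (B * h))] over the interval. The
    resulting error is uniform in [x], which [th] is not; this is what allows iteration. *)
Lemma trans_euler x A s h : 0 <= s -> 0 < h ->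
  `|trans (s + h) x A - trans s x A - h * gen (fun y => trans s y A) x|
  <= h * (B * (2 * (B * h))).
Proof.
move=> s0 h0.
have [th [th1 th2]] := trans_local_error x.
apply: (@euler_estimate R (fun t => trans t x A)
  (fun t => gen (fun y => trans t y A) x) th _ _ s h s0 h0 (th1 A) th2).
move=> t /andP[st tsh].
have -> : gen (fun y => trans t y A) x - gen (fun y => trans s y A) x =
    gen (fun y => trans t y A - trans s y A) x.
  by rewrite /gen -sumrB; apply: eq_bigr => i _; rewrite -mulrBr; congr (_ * _); ring.
apply: gen_bound => // i.
have L y : `|trans t y A - trans s y A| <= B * h.
  have := @trans_lipschitz y A s (t - s) s0; rewrite subr_ge0.
  have -> : s + (t - s) = t by ring.
  move=> /(_ st).
  move=> /le_trans; apply; rewrite ler_wpM2l ?(ltW B_gt0)//; lra.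
by apply: le_trans (ler_normB _ _) _; rewrite mulr_natl mulr2n lerD.
Qed.

(** For [h * B <= 1] this is the transition operator of a discrete-time Markov chain, as
    [euler_stepE] makes visible. *)
Definition euler_step (h : R) (f : config n -> R) x : R := f x + h * gen f x.

Lemma euler_stepB h f g x :
  euler_step h (fun y => f y - g y) x = euler_step h f x - euler_step h g x.
Proof.
rewrite /euler_step; suff -> : gen (fun y => f y - g y) x = gen f x - gen g x by ring.
by rewrite /gen -sumrB; apply: eq_bigr => i _; ring.
Qed.

Lemma euler_stepE h f x :
  euler_step h f x = (1 - h * \sum_(i < n) rate b0 b1 b2 x i) * f x +
    h * \sum_(i < n) rate b0 b1 b2 x i * f (grow x i).
Proof.
rewrite /euler_step /gen; under eq_bigr do rewrite mulrBr.
by rewrite sumrB -mulr_suml; ring.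
Qed.

Lemma step_rate_le1 h x : 0 <= h -> h * B <= 1 ->
  0 <= 1 - h * \sum_(i < n) rate b0 b1 b2 x i.
Proof.
move=> h0 hB; rewrite subr_ge0; apply: le_trans hB.
by rewrite ler_wpM2l// sum_rate_le.
Qed.

Lemma euler_step_ge0 h f : 0 <= h -> h * B <= 1 ->
  (forall y, 0 <= f y) -> forall x, 0 <= euler_step h f x.
Proof.
move=> h0 hB f0 x; rewrite euler_stepE addr_ge0 ?mulr_ge0 ?step_rate_le1//.
by apply: sumr_ge0 => i _; rewrite mulr_ge0// rate_ge0.
Qed.

Lemma euler_step_contraction h c f x : 0 <= h -> h * B <= 1 ->
  (forall y, `|f y| <= c) -> `|euler_step h f x| <= c.
Proof.
move=> h0 hB fc; have S1 := step_rate_le1 x h0 hB.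
have r0 i : 0 <= rate b0 b1 b2 x i by exact: rate_ge0.
rewrite euler_stepE; apply: le_trans (ler_normD _ _) _; rewrite !normrM.
rewrite (ger0_norm h0) [`|1 - _|]ger0_norm//.
have N1 : `|\sum_(i < n) rate b0 b1 b2 x i * f (grow x i)| <=
    \sum_(i < n) rate b0 b1 b2 x i * c.
  apply: le_trans (ler_norm_sum _ _ _) _; apply: ler_sum => i _.
  by rewrite normrM ger0_norm// ler_wpM2l.
rewrite -mulr_suml in N1; have := ler_wpM2l h0 N1.
have := ler_wpM2l S1 (fc x); lra.
Qed.

(** Each step adds one local error and, being a contraction in the uniform norm, does not amplify
    the earlier ones. *)
Lemma trans_iter_euler k h A x : 0 < h -> h * B <= 1 ->
  `|trans (k%:R * h) x A - iter k (euler_step h) \1_A x|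
  <= k%:R * (h * (B * (2 * (B * h)))).
Proof.
move=> h0 hB; elim: k x => [|k IH] x.
  by rewrite !mul0r trans0 subrr normr0.
have kh0 : 0 <= k%:R * h by rewrite mulr_ge0// ltW.
have -> : k.+1%:R * h = k%:R * h + h by rewrite -natr1; ring.
have E1 := trans_euler x A kh0 h0.
have E2 : `|euler_step h (fun y => trans (k%:R * h) y A - iter k (euler_step h) \1_A y) x|
    <= k%:R * (h * (B * (2 * (B * h)))).
  by apply: euler_step_contraction => //; exact: ltW.
have -> : trans (k%:R * h + h) x A - iter k.+1 (euler_step h) \1_A x =
  (trans (k%:R * h + h) x A - trans (k%:R * h) x A -
     h * gen (fun y => trans (k%:R * h) y A) x) +
  euler_step h (fun y => trans (k%:R * h) y A - iter k (euler_step h) \1_A y) x.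
  rewrite euler_stepB iterS; move: (euler_step h (iter _ _ _) x) => v.
  by rewrite /euler_step; ring.
apply: le_trans (ler_normD _ _) _; rewrite -natr1 mulrDl mul1r addrC lerD//.
Qed.

Lemma rate_Delta x y i : Delta x = Delta y -> rate b0 b1 b2 x i = rate b0 b1 b2 y i.
Proof.
move=> xy; have := Delta_eq i xy; have := Delta_eq (ord_pred i) xy.
rewrite ord_predK /rate /crystal_rate => h1 h2.
have -> : (x i < minn (x (ord_pred i)) (x (ordS i)))%N =
          (y i < minn (y (ord_pred i)) (y (ordS i)))%N by clear -h1 h2; lia.
have -> : (x i < maxn (x (ord_pred i)) (x (ordS i)))%N =
          (y i < maxn (y (ord_pred i)) (y (ordS i)))%N by clear -h1 h2; lia.
by [].
Qed.

Lemma indic_Delta (A : set (dstate n)) x y : Delta x = Delta y ->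
  \1_[set x | A (Delta x)] x = \1_[set x | A (Delta x)] y :> R.
Proof.
move=> xy; rewrite !indicE.
by have [Ay|Ay] := pselect (A (Delta y)); [rewrite !mem_set//= xy|rewrite !memNset//= xy].
Qed.

(** Rates compare neighbouring columns only and a growth acts on differences, so an Euler step
    preserves functions of the differences. *)
Lemma iter_euler_Delta k h (A : set (dstate n)) x y : Delta x = Delta y ->
  iter k (euler_step h) \1_[set x | A (Delta x)] x =
  iter k (euler_step h) \1_[set x | A (Delta x)] y.
Proof.
elim: k x y => [|k IH] x y xy /=.
  exact: indic_Delta.
rewrite /euler_step (IH _ _ xy) /gen; congr (_ + _ * _); apply: eq_bigr => i _.
by rewrite (rate_Delta i xy) (IH _ _ (grow_Delta i xy)) (IH _ _ xy).
Qed.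

Lemma trans_approx t e : 0 < t -> 0 < e -> exists N h, [/\ 0 < h, h * B <= 1 &
  forall A x, `|trans t x A - iter N (euler_step h) \1_A x| <= e].
Proof.
move=> t0 e0; have B0 := B_gt0.
(* With step [t / N] the accumulated error is [2 * B ^+ 2 * t ^+ 2 / N]: the first summand brings it
   below [e], the second gives [h * B <= 1]. *)
pose K := 2 * B ^+ 2 * t ^+ 2 / e + t * B.
have q0 : 0 <= 2 * B ^+ 2 * t ^+ 2 / e.
  by apply: divr_ge0; [rewrite mulr_ge0 ?sqr_ge0// mulr_ge0 ?sqr_ge0|exact: ltW].
have K0 : 0 <= K by rewrite addr_ge0// mulr_ge0// ltW.
pose N := Num.bound K; have KN := archi_boundP K0; rewrite -/N in KN.
have N0 : 0 < N%:R :> R by exact: le_lt_trans KN.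
pose h := t / N%:R; have h0 : 0 < h by rewrite divr_gt0.
have Nh : N%:R * h = t by rewrite mulrCA divff ?mulr1// gt_eqF.
have hB : h * B <= 1.
  rewrite /h mulrAC ler_pdivrMr// mul1r; apply: le_trans (ltW KN).
  by rewrite /K lerDr.
exists N, h; split=> // A x.
have := trans_iter_euler N A x h0 hB; rewrite Nh => /le_trans; apply.
rewrite mulrA Nh.
have hq : 2 * B ^+ 2 * t ^+ 2 / e <= N%:R.
  by apply: le_trans (ltW KN); rewrite /K lerDl mulr_ge0// ltW.
move: hq; rewrite ler_pdivrMr// -Nh => hq.
have : N%:R * (2 * B ^+ 2 * (N%:R * h ^+ 2)) <= N%:R * e.
  by move: hq; rewrite !expr2; nra.
by rewrite ler_pM2l// => hq2; rewrite !expr2 in hq2 *; lra.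
Qed.

(* The law of the process of differences depends on the starting point only
   through its differences. *)
Lemma trans_Delta t x y (A : set (dstate n)) : 0 <= t -> Delta x = Delta y ->
  trans t x [set x | A (Delta x)] = trans t y [set x | A (Delta x)].
Proof.
rewrite le_eqVlt => /predU1P[<-|t0] xy.
  by rewrite !trans0; exact: indic_Delta.
apply/eqP; rewrite -subr_eq0 -normr_le0; apply/ler_addgt0Pr => e e0; rewrite add0r.
have [N [h [h0 hB app]]] := trans_approx t0 (divr_gt0 e0 (ltr0n R 2)).
have := app [set x | A (Delta x)] x; have := app [set x | A (Delta x)] y.
rewrite (iter_euler_Delta _ _ _ xy) !ler_norml => /andP[y1 y2] /andP[x1 x2].
by apply/andP; split; lra.
Qed.

End Semigroup.

(** * Stationary means *)

Section StationaryMean.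
Context {R : realType} {T : Type} (K : (T -> R) -> T -> R) (x0 : T).
Implicit Types (f g : T -> R).
Context (KD : forall f g x, K (fun y => f y + g y) x = K f x + K g x)
  (KZ : forall c f x, K (fun y => c * f y) x = c * K f x)
  (K_ge0 : forall f, (forall x, 0 <= f x) -> forall x, 0 <= K f x)
  (K1 : forall x, K (cst 1) x = 1).

Lemma iterKD k f g x : iter k K (fun y => f y + g y) x = iter k K f x + iter k K g x.
Proof.
elim: k x => [//|k IH] x; rewrite !iterS -KD; congr (K _ x).
by apply/funext => y; exact: IH.
Qed.

Lemma iterKZ k c f x : iter k K (fun y => c * f y) x = c * iter k K f x.
Proof.
elim: k x => [//|k IH] x; rewrite !iterS -KZ; congr (K _ x).
by apply/funext => y; exact: IH.
Qed.

Lemma iterK_ge0 k f : (forall x, 0 <= f x) -> forall x, 0 <= iter k K f x.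
Proof. by move=> f0; elim: k => [//|k IH] x; rewrite iterS; exact: K_ge0. Qed.

Lemma iterK1 k c x : iter k K (cst c) x = c.
Proof.
have -> : cst c = (fun y => c * cst 1 y) :> (T -> R).
  by apply/funext => y /=; rewrite mulr1.
rewrite iterKZ; suff -> : iter k K (cst 1) = cst 1 by rewrite mulr1.
by elim: k => [//|k IH]; rewrite iterS IH; apply/funext => y; exact: K1.
Qed.

Lemma iterK_le k f g : (forall x, f x <= g x) -> forall x, iter k K f x <= iter k K g x.
Proof.
move=> fg x; have -> : g = (fun y => f y + (g y - f y)).
  by apply/funext => y; rewrite addrC subrK.
by rewrite iterKD lerDl iterK_ge0// => y; rewrite subr_ge0.
Qed.

Lemma iterK_bound k f M : (forall x, `|f x| <= M) -> forall x, `|iter k K f x| <= M.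
Proof.
move=> fM x; rewrite ler_norml; apply/andP; split.
  rewrite -[leLHS](iterK1 k _ x); apply: iterK_le => y.
  by have := fM y; rewrite ler_norml => /andP[].
rewrite -[leRHS](iterK1 k M x); apply: iterK_le => y.
exact: le_trans (ler_norm _) (fM y).
Qed.

Definition cesaro f (N : nat) : R := N.+1%:R^-1 * \sum_(k < N.+1) iter k K f x0.

Lemma sum_const_ord (N : nat) (M : R) : \sum_(k < N.+1) M = N.+1%:R * M.
Proof. by rewrite sumr_const card_ord mulr_natl. Qed.

Lemma cesaro_le f N M : (forall k, iter k K f x0 <= M) -> cesaro f N <= M.
Proof.
move=> fM; rewrite /cesaro ler_pdivrMl ?ltr0n// -sum_const_ord.
by apply: ler_sum => k _.
Qed.

Lemma cesaro_ge f N M : (forall k, M <= iter k K f x0) -> M <= cesaro f N.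
Proof.
move=> fM; rewrite /cesaro ler_pdivlMl ?ltr0n// -sum_const_ord.
by apply: ler_sum => k _.
Qed.

Lemma cesaroD f g N : cesaro (fun y => f y + g y) N = cesaro f N + cesaro g N.
Proof.
rewrite /cesaro -mulrDr -big_split/=; congr (_ * _).
by apply: eq_bigr => k _; rewrite iterKD.
Qed.

Lemma cesaroZ c f N : cesaro (fun y => c * f y) N = c * cesaro f N.
Proof.
rewrite /cesaro mulrCA; congr (_ * _); rewrite mulr_sumr.
by apply: eq_bigr => k _; rewrite iterKZ.
Qed.

Lemma cesaro_stationary f M N : (forall x, `|f x| <= M) ->
  `|cesaro (K f) N - cesaro f N| <= N.+1%:R^-1 * (2 * M).
Proof.
move=> fM; rewrite /cesaro -mulrBr normrM ger0_norm ?invr_ge0//.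
rewrite ler_wpM2l ?invr_ge0// -sumrB.
under eq_bigr do rewrite -iterSr.
rewrite -(big_mkord xpredT (fun k => iter k.+1 K f x0 - iter k K f x0)).
rewrite telescope_sumr//; apply: le_trans (ler_normB _ _) _.
by rewrite mulr_natl mulr2n lerD// iterK_bound.
Qed.

Definition norm_bounded f := exists M, forall x, `|f x| <= M.

(* An ultrafilter limit of Cesaro means along the orbit of a single point. *)
Lemma exists_stationary_mean : exists L : (T -> R) -> R,
  [/\ (forall f g, norm_bounded f -> norm_bounded g ->
         L (fun y => f y + g y) = L f + L g),
      (forall c f, norm_bounded f -> L (fun y => c * f y) = c * L f),
      (forall f, norm_bounded f -> L (K f) = L f) &
      (forall f M m, norm_bounded f -> (forall k, m <= iter k K f x0 <= M) ->
         m <= L f <= M)].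
Proof.
have [U [UU oU]] := ultraFilterLemma (_ : ProperFilter (\oo : set_system nat)).
have PU : ProperFilter U by exact: ultra_proper.
have cv f : norm_bounded f -> exists l : R, cesaro f N @[N --> U] --> l.
  move=> [M fM].
  have := @segment_compact R (- M) M (cesaro f N @[N --> U]) _.
  case=> [|l [_ cl]].
    have -> // : (cesaro f @ U) `[- M, M]%classic = U setT.
      congr (U _); apply/seteqP; split=> // N _ /=; rewrite in_itv /=.
      apply/andP; split.
        by apply: cesaro_ge => k; have := iterK_bound k fM x0; rewrite ler_norml => /andP[].
      by apply: cesaro_le => k; exact: le_trans (ler_norm _) (iterK_bound k fM x0).
    exact: filterT.
  (* Along an ultrafilter a cluster point is a limit. *)
  exists l => A nA; have [//|UA] := in_ultra_setVsetC (cesaro f @^-1` A) UU.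
  by have [z [] /=] := cl (~` A) A UA nA.
pose L f := lim (cesaro f N @[N --> U]).
have LP f l : cesaro f N @[N --> U] --> l -> L f = l by move=> /cvg_lim; exact.
have cvL f : norm_bounded f -> cesaro f N @[N --> U] --> L f.
  by move=> /cv[l fl]; rewrite (LP _ _ fl).
exists L; split.
- move=> f g bf bg; apply: LP; under eq_cvg do rewrite cesaroD.
  by apply: cvgD; exact: cvL.
- move=> c f bf; apply: LP; under eq_cvg do rewrite cesaroZ.
  by apply: cvgMr; exact: cvL.
- move=> f [M fM]; apply: LP.
  have bf : norm_bounded f by exists M.
  have z : cesaro (K f) N - cesaro f N @[N --> U] --> (0 : R).
    have z1 : (N.+1%:R^-1 * (2 * M)) @[N --> U] --> (0 : R).
      apply: cvg_trans (_ : N.+1%:R^-1 * (2 * M) @[N --> \oo] --> (0 : R)).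
        by move=> A; exact: oU.
      by rewrite -[X in _ --> X](mul0r (2 * M)); apply: cvgMl; exact: cvg_harmonic.
    apply: norm_cvg0; apply: (@squeeze_cvgr _ _ _ _ (cst 0) _ _ _ 0 (cvg_cst _) z1).
    by near=> N; rewrite normr_ge0 (cesaro_stationary N fM).
  have FU : Filter U by exact: filter_filter.
  have := @cvgD _ _ _ _ FU _ _ _ _ z (cvL _ bf); rewrite add0r.
  by under eq_cvg do rewrite /= subrK.
- move=> f M m bf fM; have fL := cvL _ bf; apply/andP; split.
    apply: (ler_cvg_to (cvg_cst _) fL); near=> N.
    by apply: cesaro_ge => k; case/andP: (fM k).
  apply: (ler_cvg_to fL (cvg_cst _)); near=> N.
  by apply: cesaro_le => k; case/andP: (fM k).
Unshelve. all: by end_near.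
Qed.

End StationaryMean.

Section WeightProbability.
Context {R : realType} {S : pointedType}.
Implicit Type w : S -> \bar R.

(** The two proofs are arguments so that the measure and probability instances can be attached to
    the function itself. *)
Definition weight_probability w (w_ge0 : forall z, (0 <= w z)%E)
    (w1 : \esum_(z in [set: S]) w z = 1%E) (A : set (discrete S)) : \bar R :=
  \esum_(z in (A : set S)) w z.

Context w (w_ge0 : forall z, (0 <= w z)%E) (w1 : \esum_(z in [set: S]) w z = 1%E).
Local Notation mu := (weight_probability w_ge0 w1).

Let mu0 : mu set0 = 0%E. Proof. exact: esum_set0. Qed.

Let mu_ge0 A : (0 <= mu A)%E. Proof. exact: esum_ge0. Qed.

Let mu_sigma_additive : semi_sigma_additive mu.
Proof.
move=> F _ tF _; rewrite /mu /weight_probability esum_bigcupT//.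
rewrite -nneseries_esumT => [|k]; last exact: esum_ge0.
by apply: is_cvg_nneseries => k _ _; exact: esum_ge0.
Qed.

HB.instance Definition _ := isMeasure.Build _ _ _ mu mu0 mu_ge0 mu_sigma_additive.

HB.instance Definition _ := Measure_isProbability.Build _ _ _ mu w1.

End WeightProbability.

(** * Return times and uniqueness *)

Section Past.
Context {R : realType} {d : measure_display} {Omega : measurableType d} {S : countType}
  (Y : R -> Omega -> S).
Implicit Types (s t : R) (E : set Omega).

Lemma past_mono s t : s <= t -> past Y s `<=` past Y t.
Proof.
move=> st E pE B [sB BG]; apply: pE; split=> //.
move=> _ [r [y [/andP[r0 rs] ->]]]; apply: BG; exists r, y; split=> //.
by rewrite r0 (le_trans rs).
Qed.

Lemma pastI s E E' : past Y s E -> past Y s E' -> past Y s (E `&` E').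
Proof.
move=> pE pE' B hB; have BE := pE B hB; have BE' := pE' B hB.
have [[B0 BC BU] _] := hB.
rewrite (_ : E `&` E' =
  setT `\` \bigcup_k (if k == 0%N then setT `\` E else setT `\` E')).
  by apply/(BC)/BU => k; case: ifP => _; exact: (BC).
apply/seteqP; split=> w /=.
  by move=> [Ew E'w]; split=> // -[k _]; case: ifP => _ [].
move=> [_ nU]; split; apply: contrapT => nE; apply: nU.
  by exists 0%N => //=; split.
by exists 1%N => //=; split.
Qed.

Lemma past_preimage s t (A : set S) : 0 <= t <= s -> past Y s [set w | A (Y t w)].
Proof.
move=> ts B hB; have [[B0 BC BU] BG] := hB.
rewrite (_ : [set w | _] = \bigcup_k (if @pickle_inv S k is Some y then
    (if `[< A y >] then [set w | Y t w = y] else set0) else set0)).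
  apply: BU => k; case: pickle_inv => [y|//]; case: ifP => _ //.
  by apply: BG; exists t, y.
apply/seteqP; split=> w /=.
  by move=> Aw; exists (pickle (Y t w)) => //=; rewrite pickleK_inv asboolT.
by move=> [k _]; case: pickle_inv => // y; case: asboolP => //= Ay ->.
Qed.

End Past.

Section DifferenceChain.
Context {R : realType} {n : nat} {d : measure_display} {Omega : measurableType d}
  (PD : dstate n -> probability Omega R) (DX : R -> Omega -> dstate n).
Local Notation S := (dstate n).
Implicit Types (z y : S) (A B : set S) (s t h : R) (E : set Omega) (f : S -> \bar R).
Context (DX_measurable : forall t y, 0 <= t -> measurable [set w | DX t w = y])
  (DX_start : forall z, PD z [set w | DX 0 w = z] = 1%E)
  (DX_markov : forall z s t y A E, 0 <= s -> 0 <= t -> past DX s E ->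
     PD z (E `&` [set w | DX s w = y] `&` [set w | A (DX (s + t) w)]) =
     (PD z (E `&` [set w | DX s w = y]) * PD y [set w | A (DX t w)])%E).
Local Open Scope ereal_scope.

Lemma DX_preimage t A : (0 <= t)%R -> measurable [set w | A (DX t w)].
Proof.
by move=> t0; apply: measurable_countable_preimage => y; exact: DX_measurable.
Qed.

Lemma past_DX_measurable s : past DX s `<=` measurable.
Proof.
apply: smallest_sub; first exact: sigma_algebra_measurable.
by move=> _ [t [y [/andP[t0 _] ->]]]; exact: DX_measurable.
Qed.

Definition trans_op t f z : \bar R := \int[PD z]_w f (DX t w).

Lemma trans_opE t f z : (0 <= t)%R -> (forall y, 0 <= f y) ->
  trans_op t f z = \esum_(y in [set: S]) (f y * PD z [set w | DX t w = y]).
Proof.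
move=> t0 f0; rewrite /trans_op ge0_integral_esum//.
- by apply: eq_esum => y _; rewrite setTI.
- by move=> y; exact: DX_measurable.
Qed.

Lemma trans_op_ge0 t f : (forall y, 0 <= f y) -> forall z, 0 <= trans_op t f z.
Proof. by move=> f0 z; apply: integral_ge0. Qed.

(** The Markov property for single states is summed over the states at times [s] and [s + t];
    nonnegativity allows the interchange. *)
Lemma markov_op z s t E f : (0 <= s)%R -> (0 <= t)%R -> past DX s E ->
  (forall y, 0 <= f y) ->
  \int[PD z]_(w in E) f (DX (s + t)%R w) = \int[PD z]_(w in E) trans_op t f (DX s w).
Proof.
move=> s0 t0 pE f0; have mE := past_DX_measurable pE.
have st0 : (0 <= s + t)%R by rewrite addr_ge0.
rewrite ge0_integral_esum//; last by move=> y; exact: DX_measurable.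
rewrite ge0_integral_esum//; last 2 first.
- by move=> y; exact: DX_measurable.
- exact: trans_op_ge0.
pose a x y := f y * (PD z (E `&` [set w | DX s w = x]) * PD x [set w | DX t w = y]).
transitivity (\esum_(y in [set: S]) \esum_(x in [set: S]) a x y).
  apply: eq_esum => y _.
  rewrite -(setIT (E `&` _)) (_ : setT = [set w | setT (DX s w)])//.
  rewrite (measure_esum _ _ (measurableI _ _ mE (DX_measurable y st0))); last first.
    by move=> x; exact: DX_measurable.
  rewrite -ge0_esumZl//.
  apply: eq_esum => x _; rewrite indicT mul1e /a; congr (_ * _).
  rewrite setIAC; exact: (DX_markov z x [set y]).
rewrite exchange_esum => [|x y]; last by rewrite /a !mule_ge0.
apply: eq_esum => x _; rewrite trans_opE// muleC -ge0_esumZl//; last by move=> y; rewrite mule_ge0.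
by apply: eq_esum => y _; rewrite /a muleCA.
Qed.

(** Operator of the chain observed at multiples of [h] and killed when found outside [A]; its
    iterates on [cst 1] are survival probabilities. *)
Definition killed_op A h f z : \bar R := trans_op h (fun y => (\1_A y)%:E * f y) z.

Lemma killed_op_ge0 A h f : (forall y, 0 <= f y) -> forall z, 0 <= killed_op A h f z.
Proof. by move=> f0; apply: trans_op_ge0 => y; rewrite mule_ge0// lee_fin. Qed.

Lemma iter_killed_op_ge0 A h m f : (forall y, 0 <= f y) ->
  forall z, 0 <= iter m (killed_op A h) f z.
Proof. by move=> f0; elim: m => // m IH z; rewrite iterS; exact: killed_op_ge0. Qed.

(** The [m] observations start at time [s + h]; time [s] itself is not tested. *)
Definition stays A s h m : set Omega :=
  [set w | forall i, (i < m)%N -> A (DX (s + i.+1%:R * h)%R w)].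

Lemma stays_past A s h m : (0 <= s)%R -> (0 <= h)%R ->
  past DX (s + m%:R * h)%R (stays A s h m).
Proof.
move=> s0 h0; elim: m => [|m IH].
  rewrite (_ : stays A s h 0 = [set w | setT (DX s w)]).
    by apply: past_preimage; rewrite s0 mul0r addr0 /=.
  by apply/seteqP; split.
rewrite (_ : stays A s h m.+1 =
  stays A s h m `&` [set w | A (DX (s + m.+1%:R * h)%R w)]).
  apply: pastI.
    by apply: past_mono IH; rewrite lerD2l ler_wpM2r// ler_nat.
  by apply: past_preimage; rewrite lexx addr_ge0// mulr_ge0.
apply/seteqP; split=> w /=.
  by move=> st; split; [move=> i im; apply: st; exact: ltnW|exact: st].
move=> [st Am] i; rewrite ltnS leq_eqVlt => /predU1P[->//|]; exact: st.
Qed.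

(** The past event [E] is general because the induction absorbs the first observation into it and
    restarts at time [s + h]. *)
Lemma stays_op z s h m A E f : (0 <= s)%R -> (0 <= h)%R -> past DX s E ->
  (forall y, 0 <= f y) ->
  \int[PD z]_(w in E `&` stays A s h m) f (DX (s + m%:R * h)%R w) =
  \int[PD z]_(w in E) iter m (killed_op A h) f (DX s w).
Proof.
move=> s0 h0 pE f0; elim: m s s0 E pE => [|m IH] s s0 E pE.
  rewrite mul0r addr0 (_ : stays A s h 0 = setT) ?setIT//.
  by apply/seteqP; split.
have sh0 : (0 <= s + h)%R by rewrite addr_ge0.
have tE i : (s + h + i%:R * h = s + i.+1%:R * h)%R.
  by rewrite -nat1r mulrDl mul1r addrA.
have -> : E `&` stays A s h m.+1 =
    (E `&` [set w | A (DX (s + h)%R w)]) `&` stays A (s + h)%R h m.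
  apply/seteqP; split=> w /=.
    move=> [Ew st]; split; first by split=> //; have := st 0%N isT; rewrite mul1r.
    by move=> i im; rewrite tE; exact: st.
  move=> [[Ew Aw] st]; split=> // -[|i] im; first by rewrite mul1r.
  by rewrite -tE; exact: st.
rewrite -tE IH//; last first.
  apply: pastI; first by apply: past_mono pE; rewrite lerDl.
  by apply: past_preimage; rewrite sh0 lexx.
set g := iter m _ f.
have g0 y : 0 <= g y by exact: iter_killed_op_ge0.
rewrite iterS -/g -markov_op//; last by move=> y; rewrite mule_ge0// lee_fin.
rewrite integral_mkcondr; apply: eq_integral => w _.
rewrite patchE indicE; have [Aw|nAw] := pselect (A (DX (s + h) w)).
  by rewrite !mem_set// mul1e.
by rewrite !memNset// mul0e.
Qed.

Lemma trans_op0 f z : (forall y, 0 <= f y) -> trans_op 0 f z = f z.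
Proof.
move=> f0; rewrite trans_opE//.
have p0 y : PD z [set w | DX 0 w = y] = (\1_[set z] y)%:E.
  rewrite indicE; have [<-|/eqP yz] := eqVneq z y; first by rewrite DX_start mem_set.
  rewrite memNset; last by move=> /= /esym.
  have := probability_le1 (PD z) (DX_preimage [set~ y] (lexx 0%R)).
  have := probability_setC (PD z) (DX_preimage [set~ y] (lexx 0%R)).
  rewrite (_ : ~` _ = [set w | DX 0 w = y]); last first.
    by apply/seteqP; split=> w /=; [exact: contrapT|move=> ->; exact].
  have : PD z [set w | [set~ y] (DX 0 w)] = 1.
    have mE : measurable [set w | [set~ y] (DX 0%R w)] by exact: DX_preimage.
    apply/eqP; rewrite eq_le probability_le1//=.
    rewrite -(DX_start z); apply: le_measure; rewrite ?inE.
    - exact: DX_measurable.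
    - exact: mE.
    - by move=> w /= ->.
  by move=> E1 E2 _; rewrite E2 E1 subee.
under eq_esum do rewrite p0.
rewrite -[RHS](esum_set1 (f0 z)) [RHS]esum_mkcond; apply: eq_esum => y _.
by rewrite indicE; case: (_ \in _); rewrite ?mule1 ?mule0.
Qed.

Lemma stays_prob z h m A j A' : (0 <= h)%R ->
  PD z (stays A 0 h j `&` stays A' (j%:R * h) h m) =
  iter j (killed_op A h) (iter m (killed_op A' h) (cst 1)) z.
Proof.
move=> h0; have jh0 : (0 <= j%:R * h)%R by rewrite mulr_ge0.
have pj := @stays_past A 0 h j (lexx 0%R) h0; rewrite add0r in pj.
have pm := @stays_past A' _ h m jh0 h0.
rewrite -[LHS]mul1e -integral_cst; last first.
  apply: measurableI; [exact: past_DX_measurable pj|exact: past_DX_measurable pm].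
rewrite (stays_op z m A' (f := cst 1) jh0 h0 pj)//.
rewrite -[stays A 0 h j]setTI -[X in DX X]add0r.
rewrite (stays_op z j A (lexx 0%R) h0)//; last 2 first.
- by move=> B [[B0 BC _] _]; rewrite -(setD0 setT); exact: BC.
- exact: iter_killed_op_ge0.
apply: trans_op0; do 2 apply: iter_killed_op_ge0 => //.
Qed.

Lemma esum_indic1 z (g : S -> \bar R) : (forall y, 0 <= g y) ->
  \esum_(y in [set: S]) ((\1_[set z] y)%:E * g y) = g z.
Proof.
move=> g0; rewrite -[RHS](esum_set1 (g0 z)) [RHS]esum_mkcond; apply: eq_esum => y _.
by rewrite indicE; case: (_ \in _); rewrite ?mul1e ?mul0e.
Qed.

Lemma killed_op_point z h f : (0 <= h)%R -> (forall y, 0 <= f y) ->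
  killed_op [set z] h f z = PD z [set w | DX h w = z] * f z.
Proof.
move=> h0 f0; rewrite /killed_op trans_opE//; last first.
  by move=> y; rewrite mule_ge0// lee_fin.
under eq_esum do rewrite -muleA.
by rewrite esum_indic1 1?muleC// => y; rewrite mule_ge0.
Qed.

Section Invariant.
Context (p : probability (discrete S) R) (p_inv : invariant_measure PD DX p).

Lemma integral_discrete f : (forall y, 0 <= f y) ->
  \int[p]_y f y = \esum_(y in [set: S]) (f y * p [set y]).
Proof.
move=> f0; rewrite (@ge0_integral_esum _ _ _ _ _ _ (fun y : discrete S => y : S))//.
by apply: eq_esum => y _; rewrite setTI.
Qed.

Lemma invariant_op t f : (0 <= t)%R -> (forall y, 0 <= f y) ->
  \int[p]_z trans_op t f z = \int[p]_z f z.
Proof.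
move=> t0 f0; rewrite !integral_discrete//; last exact: trans_op_ge0.
transitivity (\esum_(z in [set: S]) \esum_(y in [set: S])
    (f y * (PD z [set w | DX t w = y] * p [set z]))).
  apply: eq_esum => z _; rewrite trans_opE// muleC -ge0_esumZl//.
    by apply: eq_esum => y _; rewrite muleCA [p _ * _]muleC.
  by move=> y; rewrite mule_ge0.
rewrite exchange_esum => [|x y]; last by rewrite !mule_ge0.
apply: eq_esum => y _; rewrite ge0_esumZl//; last by move=> z; rewrite mule_ge0.
congr (_ * _); rewrite -(p_inv [set y] t0) integral_discrete//.
Qed.

(* Kac: [p z] times the probability of avoiding [z] at the first [m] steps is
   the decrement at [m] of a nonincreasing sequence. *)
Lemma kac_bound h z (M : nat) : (0 <= h)%R ->
  \sum_(m < M) (iter m (killed_op (~` [set z]) h) (cst 1) z * p [set z]) <= 1.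
Proof.
move=> h0; pose N m := iter m (killed_op (~` [set z]) h) (cst 1).
have N0 m y : 0 <= N m y by exact: iter_killed_op_ge0.
(* Invariance turns the integral of [N m] over the complement of [z] into the full integral of
   [N m.+1]. *)
have step m : \int[p]_y N m y = N m z * p [set z] + \int[p]_y N m.+1 y.
  rewrite [in RHS]/N iterS -/(N m) /killed_op invariant_op//; last first.
    by move=> y; rewrite mule_ge0// lee_fin.
  rewrite !integral_discrete//; last by move=> y; rewrite mule_ge0// lee_fin.
  rewrite -[X in X + _](@esum_indic1 z (fun y => N m y * p [set y])); last first.
    by move=> y; rewrite mule_ge0.
  rewrite -esumD; first last.
  - by move=> y _; rewrite !mule_ge0// lee_fin.
  - by move=> y _; rewrite !mule_ge0// lee_fin.
  apply: eq_esum => y _; rewrite !indicE in_setC.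
  by case: (_ \in _); rewrite /= ?mul1e ?mul0e ?adde0 ?add0e.
suff H : \sum_(m < M) (N m z * p [set z]) + \int[p]_y N M y = 1.
  by rewrite -[leRHS]H leeDl// integral_ge0.
elim: M => [|M IH].
  by rewrite big_ord0 add0e integral_cst// mul1e; exact: probability_setT.
by rewrite big_ord_recr/= -addeA -step.
Qed.

End Invariant.

Lemma return_time_le w z h i j k : (0 <= h)%R -> (i <= j <= k)%N ->
  DX (i%:R * h) w <> z -> DX (j%:R * h) w = z ->
  return_time DX z w <= (k%:R * h)%:E.
Proof.
move=> h0 /andP[ij jk] iz jz; apply: (@le_trans _ _ (j%:R * h)%:E); last first.
  by rewrite lee_fin ler_wpM2r// ler_nat.
apply: ereal_inf_lbound; exists (j%:R * h)%R => //=.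
split; first by rewrite mulr_ge0.
split=> //; exists (i%:R * h)%R; split=> //.
by rewrite mulr_ge0// ler_wpM2r// ler_nat.
Qed.

Definition leaves_once z h (j m : nat) : set Omega :=
  stays [set z] 0 h j `&` stays (~` [set z]) (j%:R * h) h m.

(** The event for [j = k] excludes that [z] is seen at all [k] observations. If the path is first
    seen off [z] at observation [i.+1], the event for [j = i] excludes that it is off [z] from there
    up to observation [k]; hence it has returned. *)
Lemma not_leaves_once w z h k : (0 <= h)%R ->
  (forall j, (j <= k)%N -> ~ leaves_once z h j (k - j) w) ->
  return_time DX z w <= (k%:R * h)%:E.
Proof.
move=> h0 nE.
have [i ik iz] : exists2 i, (i < k)%N & DX (i.+1%:R * h)%R w <> z.
  apply: contrapT => H; apply: (nE k (leqnn k)); split.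
    by move=> i ik; rewrite add0r; apply: contrapT => iz; apply: H; exists i.
  by move=> i; rewrite subnn.
have ex : exists i, (i < k)%N && (DX (i.+1%:R * h)%R w != z).
  by exists i; rewrite ik; exact/eqP.
case: (ex_minnP ex) => {iz}{ik}i /andP[ik /eqP iz] imin.
have : ~ stays (~` [set z]) (i%:R * h) h (k - i) w.
  move=> st; apply: (nE i (ltnW ik)); split=> // j ji; rewrite add0r /=.
  apply/eqP/negPn/negP => jz; have := imin j; rewrite (ltn_trans ji ik) jz => /(_ isT).
  by rewrite leqNgt ji.
move=> /existsNP[j /not_implyP[jk]] /contrapT /= jz.
apply: (@return_time_le w z h i.+1 (i + j.+1) k) => //.
  by rewrite addnS ltnS leq_addr/= -ltn_subRL.
by rewrite natrD mulrDl.
Qed.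

Lemma leaves_once_prob z h j m : (0 <= h)%R ->
  PD z (leaves_once z h j m) =
  PD z [set w | DX h w = z] ^+ j * iter m (killed_op (~` [set z]) h) (cst 1) z.
Proof.
move=> h0; rewrite /leaves_once stays_prob//; set N := iter m _ _.
have N0 y : 0 <= N y by exact: iter_killed_op_ge0.
elim: j => [|j IH]; first by rewrite expe0 mul1e.
rewrite iterS killed_op_point//; last exact: iter_killed_op_ge0.
by rewrite IH muleA -expeS.
Qed.

Lemma leaves_once_measurable z h j m : (0 <= h)%R -> measurable (leaves_once z h j m).
Proof.
move=> h0; apply: measurableI.
  by have := @stays_past [set z] 0 h j (lexx 0%R) h0; exact: past_DX_measurable.
have jh0 : (0 <= j%:R * h)%R by rewrite mulr_ge0.
by have := @stays_past (~` [set z]) _ h m jh0 h0; exact: past_DX_measurable.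
Qed.

(** A term is at least [h] as soon as one of its events occurs. At the first [k] whose term is
    smaller, none occurs, so the return time is at most [k * h], which the earlier terms add up to;
    if there is no such [k], the series diverges. *)
Lemma return_time_series z h w : (0 < h)%R ->
  return_time DX z w <= \sum_(k <oo) \sum_(j < k.+1)
    (h * \1_(leaves_once z h j (k - j)) w)%:E.
Proof.
move=> h0; pose u k := \sum_(j < k.+1) (h * \1_(leaves_once z h j (k - j)) w)%:E.
rewrite -/(u _).
have t0 k (j : 'I_k.+1) : 0 <= (h * \1_(leaves_once z h j (k - j)) w)%:E.
  by rewrite lee_fin mulr_ge0// ltW.
have u0 k : 0 <= u k by apply: sume_ge0 => j _.
have uh k j : (j <= k)%N -> leaves_once z h j (k - j) w -> h%:E <= u k.
  move=> jk E; rewrite /u (bigD1 (Ordinal (jk : (j < k.+1)%N)))//=.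
  rewrite indicE mem_set// mulr1 leeDl//; apply: sume_ge0 => i _; exact: t0.
have partial M : (forall k, (k < M)%N -> h%:E <= u k) ->
    (M%:R * h)%:E <= \sum_(k <oo) u k.
  move=> uM; apply: le_trans (nneseries_lim_ge M _); last by move=> k _ _; exact: u0.
  rewrite big_mkord mulr_natl -[M in (_ *+ M)%R]card_ord -sumr_const -sumEFin.
  by apply: lee_sum => k _; exact: uM.
have [[k uk]|nex] := pselect (exists k, ~ (h%:E <= u k)).
  have ex : exists k, ~~ (h%:E <= u k) by exists k; exact/negP.
  case: (ex_minnP ex) => {uk} {}k uk kmin.
  apply: (@le_trans _ _ (k%:R * h)%:E).
    apply: not_leaves_once; first exact: ltW.
    by move=> j jk E; move/negP: uk; apply; exact: uh E.
  apply: partial => i ik; apply: contraT => ui; have := kmin i ui.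
  by rewrite leqNgt ik.
rewrite (_ : \sum_(k <oo) u k = +oo) ?leey//; apply: eq_infty => r.
have [r0|r0] := ltP r 0%R.
  by apply: (@le_trans _ _ 0); [rewrite lee_fin ltW|exact: nneseries_ge0].
have rh0 : (0 <= r / h)%R by rewrite divr_ge0// ltW.
apply: (@le_trans _ _ ((Num.bound (r / h))%:R * h)%:E).
  by rewrite lee_fin -ler_pdivrMr// ltW// archi_boundP.
by apply: partial => k _; apply: contrapT => nuk; apply: nex; exists k.
Qed.

(** The inner sums satisfy [e k.+1 = N k.+1 + rho * e k], so a partial sum is at most [C + rho]
    times the previous one, and [C / (1 - rho)] is the fixed point of this recursion. *)
Lemma convolution_le (N : nat -> R) (rho C : R) :
  (0 <= rho < 1)%R -> (forall m, 0 <= N m)%R ->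
  (forall M, \sum_(m < M) N m <= C)%R ->
  forall M, (\sum_(k < M) \sum_(j < k.+1) rho ^+ j * N (k - j)%N <= C / (1 - rho))%R.
Proof.
move=> /andP[r0 r1] N0 NC.
pose e k := (\sum_(j < k.+1) rho ^+ j * N (k - j)%N)%R.
have r1' : (0 < 1 - rho)%R by rewrite subr_gt0.
have eS k : (e k.+1 = N k.+1 + rho * e k)%R.
  rewrite /e big_ord_recl expr0 mul1r subn0; congr (_ + _)%R.
  by rewrite mulr_sumr; apply: eq_bigr => j _; rewrite /= /bump/= exprS mulrA add1n subSS.
have C0 : (0 <= C)%R by have := NC 0%N; rewrite big_ord0.
elim=> [|M IH]; first by rewrite big_ord0 divr_ge0// ltW.
rewrite big_ord_recl -/(e 0%N).
have -> : e 0%N = N 0%N by rewrite /e big_ord1 expr0 mul1r.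
rewrite (eq_bigr (fun k : 'I_M => N k.+1 + rho * e k)%R) => [|k _]; last exact: eS.
rewrite big_split/= -mulr_sumr addrA.
have := NC M.+1; rewrite big_ord_recl => NM.
have := ler_wpM2l r0 IH.
rewrite -/e => H; apply: (le_trans (lerD NM H)).
rewrite -[X in (X + _)%R]mulr1 -[X in (C * X)%R](divff (lt0r_neq0 r1')).
by rewrite le_eqVlt; apply/orP; left; apply/eqP; field; exact: lt0r_neq0.
Qed.

(** Stated without measurability because it is applied to [return_time]: the integral of a
    nonnegative function is a supremum over simple functions below it. *)
Lemma le_integral_ge0 (mu : probability Omega R) (f g : Omega -> \bar R) :
  (forall w, 0 <= f w) -> (forall w, f w <= g w) ->
  \int[mu]_w f w <= \int[mu]_w g w.
Proof.
move=> f0 fg; rewrite !ge0_integralTE//; last by move=> w; exact: le_trans (fg w).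
apply: ereal_sup_le => _ [h hf <-]; exists h => // w; exact: le_trans (hf w) (fg w).
Qed.

(** The stay at [z] before the first departure has a geometric tail of ratio [rho], and the survival
    probabilities away from [z] sum to at most the inverse of [p [set z]] by [kac_bound]; their
    convolution bounds the expectation. *)
Lemma return_time_integrable (p : probability (discrete S) R) z h :
  invariant_measure PD DX p -> (0 < h)%R -> 0 < p [set z] ->
  PD z [set w | DX h w = z] < 1 ->
  \int[PD z]_w return_time DX z w < +oo.
Proof.
move=> p_inv h0 pz rho1; have h0' := ltW h0.
pose N m := iter m (killed_op (~` [set z]) h) (cst 1) z.
have N0 m : 0 <= N m by exact: iter_killed_op_ge0.
have N_prob m : N m = PD z (leaves_once z h 0 m).
  by rewrite leaves_once_prob// expe0 mul1e.
have N_fin m : N m = (fine (N m))%:E.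
  rewrite fineK// N_prob fin_num_measure//; exact: leaves_once_measurable.
have rhoE : PD z [set w | DX h w = z] = (fine (PD z [set w | DX h w = z]))%:E.
  by rewrite fineK// fin_num_measure//; exact: DX_measurable.
have pE : p [set z] = (fine (p [set z]))%:E by rewrite fineK// fin_num_measure.
set rho := fine _ in rhoE; set pr := fine _ in pE.
have pr0 : (0 < pr)%R by rewrite -lte_fin -pE.
have rho01 : (0 <= rho < 1)%R by rewrite fine_ge0//= -lte_fin -rhoE.
have NC M : (\sum_(m < M) fine (N m) <= pr^-1)%R.
  rewrite -(ler_pM2r pr0) mulVf ?gt_eqF// mulr_suml -lee_fin -sumEFin.
  apply: le_trans (kac_bound p_inv z M h0').
  by apply: lee_sum => m _; rewrite EFinM -pE -N_fin.
have conv := convolution_le rho01 (fun m => fine_ge0 (N0 m)) NC.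
have rt0 w : 0 <= return_time DX z w.
  by apply: le_ereal_inf_tmp => _ [t [t0 _] <-]; rewrite lee_fin.
apply: le_lt_trans (le_integral_ge0 _ rt0 (fun w => return_time_series z w h0)) _.
pose T k (j : 'I_k.+1) w := (h * \1_(leaves_once z h j (k - j)) w)%:E.
have mT k j : measurable_fun setT (@T k j).
  apply/measurable_EFinP; apply: measurable_funM => //.
  apply: measurable_indic; exact: leaves_once_measurable.
have T0 k j w : 0 <= @T k j w by rewrite lee_fin mulr_ge0.
rewrite integral_nneseries//; last 2 first.
- by move=> k; apply: emeasurable_sum => j; exact: mT.
- by move=> k w _; apply: sume_ge0 => j _; exact: T0.
apply: (@le_lt_trans _ _ (h * (pr^-1 / (1 - rho)))%:E); last exact: ltry.
apply: lime_le.
  apply: is_cvg_nneseries => k _ _; apply: integral_ge0 => w _.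
  by apply: sume_ge0 => j _; exact: T0.
apply: nearW => M; rewrite big_mkord.
apply: (@le_trans _ _ (h * \sum_(k < M) \sum_(j < k.+1) rho ^+ j * fine (N (k - j)%N))%:E).
  rewrite mulr_sumr -sumEFin; apply: lee_sum => k _.
  rewrite (@ge0_integral_sum _ _ _ _ _ measurableT _ (@T k) (@mT k)); last first.
    by move=> j w _; exact: T0.
  rewrite mulr_sumr -sumEFin; apply: lee_sum => j _.
  rewrite /T; under eq_integral do rewrite EFinM.
  rewrite ge0_integralZl//; last first.
    apply/measurable_EFinP; apply: measurable_indic; exact: leaves_once_measurable.
  rewrite integral_indic//; last exact: leaves_once_measurable.
  have LP := leaves_once_prob z j (k - j) h0'.
  rewrite -/(N _) rhoE -EFin_expe N_fin in LP.
  by rewrite setIT [X in _ * X](_ : _ = (rho ^+ j * fine (N (k - j)%N))%:E).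
by rewrite lee_fin ler_wpM2l// conv.
Qed.

Lemma discrete_probE (p : probability (discrete S) R) A :
  p A = \esum_(y in [set: S]) ((\1_A y)%:E * p [set y]).
Proof.
rewrite -[LHS](congr1 p (setTI A)).
rewrite (measure_esum p (Y := fun y : discrete S => y : S) A measurableT)//.
by apply: eq_esum => y _; rewrite setTI.
Qed.

Lemma discrete_prob_fin (p : probability (discrete S) R) A : p A = (fine (p A))%:E.
Proof. by rewrite fineK// fin_num_measure. Qed.

Lemma esum_le_eq (a b : S -> \bar R) : (forall y, 0 <= b y <= a y) ->
  \esum_(y in [set: S]) a y = \esum_(y in [set: S]) b y ->
  \esum_(y in [set: S]) b y < +oo -> forall y, a y = b y.
Proof.
move=> ab eab bfin y.
have b0 x : 0 <= b x by case/andP: (ab x).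
have Bfin : \esum_(y in [set: S]) b y \is a fin_num by rewrite ge0_fin_numE// esum_ge0.
have bf x : b x \is a fin_num.
  by rewrite ge0_fin_numE//; apply: le_lt_trans bfin; exact: le_esum1.
have d0 x : 0 <= a x - b x by rewrite sube_ge0 ?bf//; case/andP: (ab x).
have : \esum_(y in [set: S]) a y =
    \esum_(y in [set: S]) b y + \esum_(y in [set: S]) (a y - b y).
  by rewrite -esumD//; apply: eq_esum => x _; rewrite addeC subeK.
rewrite eab => /esym H.
have D0 : \esum_(y in [set: S]) (a y - b y) = 0.
  have Dp : 0 <= \esum_(y in [set: S]) (a y - b y) by apply: esum_ge0.
  have := congr1 (fun u => u - \esum_(y in [set: S]) b y) H.
  by rewrite addeC addeK// subee.
have := le_esum1 y d0; rewrite D0 sube_le0 => aleb.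
by apply/eqP; rewrite eq_le aleb; case/andP: (ab y).
Qed.

(** * Uniqueness of the invariant probability *)

Section Uniqueness.
Context (irr : irreducible PD DX).

(** Some state has positive mass, and irreducibility carries part of it to [z]. *)
Lemma invariant_pos (p : probability (discrete S) R) z :
  invariant_measure PD DX p -> 0 < p [set z].
Proof.
move=> p_inv.
have [y py] : exists y, 0 < p [set y].
  apply: contrapT => /forallNP np.
  have := probability_setT p; rewrite discrete_probE esum1.
    by move/esym/eqP; rewrite onee_eq0.
  move=> y _; have := np y; rewrite lt0e measure_ge0 andbT => /negP/negPn/eqP ->.
  by rewrite mule0.
have [t [t0 pt]] := irr y z.
rewrite -(p_inv t [set z] t0) integral_discrete//.
apply: lt_le_trans (le_esum1 y _); first exact: mule_gt0.
by move=> x; rewrite mule_ge0.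
Qed.

(* With [B] the set where [p] exceeds [p'] and [q y] the probability of being in
   [B] at time [t] from [y], invariance makes the sum of the nonnegative terms
   [(p y - p' y) * (1_B y - q y)] vanish. So [B] is never left, hence it is the
   whole space by irreducibility, although [p] and [p'] have equal mass. *)
Lemma invariant_le (p p' : probability (discrete S) R) :
  invariant_measure PD DX p -> invariant_measure PD DX p' ->
  forall y, p [set y] <= p' [set y].
Proof.
move=> p_inv p'_inv z; rewrite leNgt; apply/negP => zB.
pose w y := fine (p [set y]); pose w' y := fine (p' [set y]).
have pE y : p [set y] = (w y)%:E := discrete_prob_fin p [set y].
have p'E y : p' [set y] = (w' y)%:E := discrete_prob_fin p' [set y].
pose B : set S := [set y | (w' y < w y)%R].
have {}zB : B z by rewrite /B /= -lte_fin -pE -p'E.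
have qz t : (0 <= t)%R -> PD z [set x | B (DX t x)] = 1.
  move=> t0; have mB : measurable [set x | B (DX t x)] by exact: DX_preimage.
  pose q y := fine (PD y [set x | B (DX t x)]).
  have qE y : PD y [set x | B (DX t x)] = (q y)%:E by rewrite fineK// fin_num_measure.
  have q0 y : (0 <= q y)%R by exact: fine_ge0.
  have q1 y : (q y <= 1)%R by rewrite -lee_fin -qE probability_le1.
  have w0 y : (0 <= w y)%R by exact: fine_ge0.
  have w'0 y : (0 <= w' y)%R by exact: fine_ge0.
  pose a y := ((w y * \1_B y)%:E + (w' y * q y)%:E).
  pose b y := ((w' y * \1_B y)%:E + (w y * q y)%:E).
  have SB (r : probability (discrete S) R) v : (forall y, r [set y] = (v y)%:E) ->
      \esum_(y in [set: S]) (v y * \1_B y)%:E = r B.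
    move=> rE; rewrite discrete_probE; apply: eq_esum => y _.
    by rewrite rE -EFinM mulrC.
  have SQ (r : probability (discrete S) R) v : (forall y, r [set y] = (v y)%:E) ->
      invariant_measure PD DX r -> \esum_(y in [set: S]) (v y * q y)%:E = r B.
    move=> rE r_inv; rewrite -(r_inv t B t0) integral_discrete//.
    by apply: eq_esum => y _; rewrite rE qE -EFinM mulrC.
  have nn v (v0 : forall y, (0 <= v y)%R) y : 0 <= (v y * \1_B y)%:E.
    by rewrite lee_fin mulr_ge0.
  have nq v (v0 : forall y, (0 <= v y)%R) y : 0 <= (v y * q y)%:E.
    by rewrite lee_fin mulr_ge0.
  have Sa : \esum_(y in [set: S]) a y = p B + p' B.
    rewrite esumD => [|y _|y _]; [|exact: nn|exact: nq].
    by rewrite (SB p w pE) (SQ p' w' p'E p'_inv).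
  have Sb : \esum_(y in [set: S]) b y = p B + p' B.
    rewrite esumD => [|y _|y _]; [|exact: nn|exact: nq].
    by rewrite (SB p' w' p'E) (SQ p w pE p_inv) addeC.
  have ba y : 0 <= b y <= a y.
    rewrite /a /b -!EFinD !lee_fin; apply/andP; split.
      by rewrite addr_ge0 ?mulr_ge0.
    rewrite indicE; have [By|By] := pselect (B y).
      rewrite mem_set//= !mulr1 -subr_ge0.
      have : (0 <= (w y - w' y) * (1 - q y))%R by rewrite mulr_ge0 ?subr_ge0// ltW.
      lra.
    rewrite memNset//; have : (w y <= w' y)%R by rewrite leNgt; exact/negP.
    move=> ww; rewrite /= !mulr0 !add0r.
    by rewrite ler_wpM2r.
  have := esum_le_eq ba (etrans Sa (esym Sb)) _ z; rewrite Sb.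
  rewrite ltey_eq fin_numD !fin_num_measure// => /(_ isT).
  rewrite /a /b -!EFinD => -[]; rewrite indicE mem_set// !mulr1 => e.
  rewrite qE; congr (_%:E); have wz : (w' z < w z)%R by exact: zB.
  have /eqP : ((w z - w' z) * (1 - q z) = 0)%R by lra.
  by rewrite mulf_eq0 subr_eq0 gt_eqF//= subr_eq0 => /eqP.
have allB y : B y.
  apply: contrapT => nBy; have [t [t0]] := irr z y.
  apply/negP; rewrite -leNgt.
  have mB : measurable [set x | B (DX t x)] by exact: DX_preimage.
  have E := probability_setC (PD z) mB.
  have qt := qz t t0.
  have E0 : PD z (~` [set x | B (DX t x)]) = 0 by rewrite E qt subee.
  rewrite -E0; apply: le_measure; rewrite ?inE.
  - exact: DX_measurable.
  - exact: measurableC.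
  - by move=> x /= ->.
have tot (r : probability (discrete S) R) : \esum_(y in [set: S]) r [set y] = 1.
  rewrite -(probability_setT r) discrete_probE; apply: eq_esum => y _.
  by rewrite indicT mul1e.
have ww y : 0 <= p' [set y] <= p [set y].
  by rewrite measure_ge0 pE p'E lee_fin ltW//; exact: allB.
have := esum_le_eq ww (etrans (tot p) (esym (tot p'))) _ z.
rewrite tot ltry => /(_ isT); rewrite pE p'E => -[] wz.
by have := zB; rewrite /B /= wz ltxx.
Qed.

Lemma invariant_unique (p p' : probability (discrete S) R) :
  invariant_measure PD DX p -> invariant_measure PD DX p' ->
  forall A, p' A = p A.
Proof.
move=> p_inv p'_inv A; rewrite !discrete_probE; apply: eq_esum => y _.
by congr (_ * _); apply/eqP; rewrite eq_le !invariant_le.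
Qed.

End Uniqueness.

End DifferenceChain.

(** * The process of differences *)

Section CrystalDifferences.
Context {R : realType} (b0 b1 b2 : R) {n : nat}.
Context (b0_gt0 : 0 < b0) (b01 : b0 < b1) (b12 : b1 < b2) (n_ge2 : (2 <= n)%N).
Context {d : measure_display} {Omega : measurableType d}
  (P : config n -> probability Omega R) (X : R -> Omega -> config n)
  (XP : crystal_growth_process b0 b1 b2 P X)
  (lift : dstate n -> config n) (liftK : cancel lift (@Delta n)).
Implicit Types (x : config n) (z y : dstate n) (s t h : R) (A : set (dstate n)).
Local Notation PD := (fun z : dstate n => P (lift z)).
Local Notation DX := (fun (t : R) (w : Omega) => Delta (X t w)).
Local Notation trans := (trans P X).

Let n_gt0 : (0 < n)%N := ltnW n_ge2.

Lemma difference_measurable t y : 0 <= t -> measurable [set w | DX t w = y].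
Proof. exact: (process_measurable XP [set x | Delta x = y]). Qed.

Lemma difference_start z : PD z [set w | DX 0 w = z] = 1%E.
Proof.
have := @transE _ _ _ _ _ _ _ _ _ XP 0 (lift z) [set x | Delta x = z] (lexx 0).
by rewrite (trans0 XP) indicE mem_set//= => <-.
Qed.

Lemma past_difference s : past DX s `<=` past X s.
Proof.
move=> E pE B hB; apply: pE; split; first by case: hB.
move=> _ [r [y [rs ->]]].
by have := @past_preimage _ _ _ _ X s r [set x | Delta x = y] rs; apply.
Qed.

(** The event is split by the configuration [x] at time [s]. By [trans_Delta] all [x] with
    differences [y] give the same law to the future differences, that of a start from [lift y]. *)
Lemma difference_markov z s t y A E : 0 <= s -> 0 <= t -> past DX s E ->
  PD z (E `&` [set w | DX s w = y] `&` [set w | A (DX (s + t) w)]) =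
  (PD z (E `&` [set w | DX s w = y]) * PD y [set w | A (DX t w)])%E.
Proof.
move=> s0 t0 /past_difference pE; have st0 : 0 <= s + t by rewrite addr_ge0.
have mE := past_measurable XP pE.
have mX x : measurable [set w | X s w = x] by exact: (process_measurable XP [set x]).
have mEA : measurable (E `&` [set w | DX s w = y] `&` [set w | A (DX (s + t) w)]).
  apply: measurableI; last exact: (process_measurable XP [set x | A (Delta x)]).
  by apply: measurableI => //; exact: difference_measurable.
rewrite -[X in PD z X]setIT (measure_esum (PD z) setT mEA mX).
rewrite (measure_esum (PD z) [set x | Delta x = y] mE mX).
have -> : PD y [set w | A (DX t w)] = (trans t (lift y) [set x | A (Delta x)])%:E.
  by rewrite (transE XP).
rewrite muleC -ge0_esumZl; last 2 first.
- by rewrite lee_fin trans_ge0.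
- by move=> x; rewrite mule_ge0// lee_fin.
apply: eq_esum => x _; rewrite indicT mul1e.
have [xy|xy] := pselect (Delta x = y); last first.
  rewrite indicE memNset// mul0e mule0 (_ : _ `&` _ = set0) ?measure0//.
  by apply/seteqP; split=> w //= [[[_ wy] _] wx]; apply: xy; rewrite -wx.
rewrite indicE mem_set// mul1e.
rewrite -(trans_Delta b0_gt0 b01 b12 n_gt0 XP A t0 (_ : Delta x = Delta (lift y))); last by rewrite liftK.
rewrite muleC; transitivity (P (lift z) (E `&` [set w | X s w = x] `&`
    [set w | [set x | A (Delta x)] (X (s + t) w)])).
  congr (P (lift z) _); apply/seteqP; split=> w /=.
    by move=> [[[Ew _] Aw] wx].
  by move=> [[Ew wx] Aw]; rewrite wx.
exact: (markov_set XP).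
Qed.

Lemma generator_grow x i : crystal_generator b0 b1 b2 x (grow x i) = rate b0 b1 b2 x i.
Proof.
rewrite /crystal_generator (bigD1 i)//= eqxx eq_sym (negbTE (grow_neq x i)) subr0 mulr1.
rewrite big1 ?addr0// => j ji; rewrite (inj_eq (@grow_inj _ x)) (negbTE ji).
by rewrite subrr mulr0.
Qed.

(** A positive off-diagonal rate forces a positive probability at all small times. *)
Lemma trans_grow_gt0 x i : exists2 h, 0 < h & 0 < trans h x [set grow x i].
Proof.
have := @mjp_rates _ _ _ _ _ _ _ XP x (grow x i); rewrite generator_grow.
rewrite [x == _]eq_sym (negbTE (grow_neq x i)) => /cvgr_gt/(_ 0).
have r0 := rate_gt0 b0_gt0 b01 b12 x i => /(_ r0) near0.
have : \forall h \near (0 : R)^'+, 0 < h /\ 0 < trans h x [set grow x i].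
  near=> h; have h0 : 0 < h by near: h; exact: nbhs_right_gt.
  split=> //; have : 0 < (trans h x [set grow x i] - 0) / h by near: h.
  by rewrite subr0 pmulr_lgt0// invr_gt0.
by move=> /filter_ex[h [h0 p0]]; exists h.
Unshelve. all: by end_near.
Qed.

Lemma trans_mul_le x x' s t (A : set (config n)) : 0 <= s -> 0 <= t ->
  trans s x [set x'] * trans t x' A <= trans (s + t) x A.
Proof.
move=> s0 t0; have st0 : 0 <= s + t by rewrite addr_ge0.
rewrite -lee_fin EFinM !(transE XP)//.
have := markov_set XP x x' A s0 t0 (@past_setT _ _ _ _ X s).
rewrite (transE XP)// setTI => <-; apply: le_measure; rewrite ?inE.
- apply: measurableI; last exact: (process_measurable XP).
  exact: (process_measurable XP [set x']).
- exact: (process_measurable XP).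
- by move=> w [].
Qed.

Lemma trans_reach x x' : (forall i, (x i <= x' i)%N) ->
  exists2 t, 0 <= t & 0 < trans t x [set x'].
Proof.
move: {2}(\sum_(i < n) (x' i - x i)%N)%N (erefl (\sum_(i < n) (x' i - x i)%N)%N).
move=> m; elim: m x => [|m IH] x mE xx'.
  exists 0 => //; rewrite (trans0 XP) indicE mem_set//=.
  apply/ffunP => i; apply/eqP; rewrite eqn_leq xx' /=.
  by move/eqP: mE; rewrite sum_nat_eq0 => /forallP/(_ i); rewrite subn_eq0.
have [i xi] : exists i, (x i < x' i)%N.
  apply: contrapT => /forallNP ge; move: mE; rewrite big1// => i _.
  by apply/eqP; rewrite subn_eq0 leqNgt; apply/negP; exact: ge.
have [h h0 p0] := trans_grow_gt0 x i.
have [||t t0 q0] := IH (grow x i).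
- move: mE; rewrite (bigD1 i)//= [in X in _ -> X](bigD1 i)//= ffunE eqxx.
  have -> : (\sum_(j < n | j != i) (x' j - grow x i j) =
             \sum_(j < n | j != i) (x' j - x j))%N.
    by apply: eq_bigr => j ji; rewrite ffunE (negbTE ji) addn0.
  by rewrite addn1; move: (\sum_(j < n | _) _)%N xi => S; clear; lia.
- by move=> j; rewrite ffunE; case: eqP => [->|_]; rewrite ?addn0// addn1.
exists (h + t); first by rewrite addr_ge0// ltW.
apply: lt_le_trans (trans_mul_le x (grow x i) [set x'] (ltW h0) t0).
by rewrite mulr_gt0.
Qed.

Lemma trans_sub_prob z x t y : 0 <= t -> Delta x = y ->
  ((trans t (lift z) [set x])%:E <= PD z [set w | DX t w = y])%E.
Proof.
move=> t0 xy; rewrite (transE XP)//; apply: le_measure; rewrite ?inE.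
- exact: (process_measurable XP [set x]).
- exact: difference_measurable.
- by move=> w /= ->.
Qed.

Lemma difference_irreducible : irreducible PD DX.
Proof.
move=> z y.
(* Raising all columns of [lift y] by the total height of [lift z] keeps the differences and puts
   the target above [lift z], where growth can reach it. *)
pose c := (\sum_(i < n) lift z i)%N.
pose x' : config n := [ffun i => (lift y i + c)%N].
have x'y : Delta x' = y.
  rewrite -[RHS]liftK; apply: val_inj; apply/ffunP => i; rewrite !ffunE !PoszD.
  by ring.
have [|t t0 p0] := @trans_reach (lift z) x'.
  by move=> i; rewrite ffunE /c (bigD1 i)//= addnCA leq_addr.
exists t; split=> //; apply: lt_le_trans (trans_sub_prob z t0 x'y).
by rewrite lte_fin.
Qed.

Lemma Delta_grow_neq x i : Delta (grow x i) <> Delta x.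
Proof.
move=> /(Delta_eq i); rewrite !ffunE eqxx addn1.
by rewrite (negbTE (ordS_neq n_ge2 i)) addn0; clear; lia.
Qed.

(** Supplies the observation step and the ratio below one for the geometric stay at [z]. *)
Lemma difference_leave z : exists2 h, 0 < h & (PD z [set w | DX h w = z] < 1)%E.
Proof.
have [h h0 p0] := trans_grow_gt0 (lift z) (Ordinal n_gt0).
exists h => //; set g := grow _ _ in p0; have h0' := ltW h0.
have mz := difference_measurable z h0'.
have : ((trans h (lift z) [set g])%:E <= PD z (~` [set w | DX h w = z]))%E.
  rewrite (transE XP)//; apply: le_measure; rewrite ?inE.
  - exact: (process_measurable XP [set g]).
  - exact: measurableC.
  - by move=> w /= -> gz; apply: (@Delta_grow_neq (lift z) (Ordinal n_gt0)); rewrite liftK.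
have E := probability_setC (PD z) mz.
have F : PD z [set w | DX h w = z] \is a fin_num by rewrite fin_num_measure.
rewrite E -(fineK F) -EFinB lee_fin lte_fin => H; lra.
Qed.

End CrystalDifferences.

(** * The invariant measure *)

Section TightMean.
Context {R : realType} {n : nat}.
Local Notation S := (dstate n).
Context (M : (S -> R) -> R).
Implicit Types (f g : S -> R) (z y : S).
Context (MD : forall f g, norm_bounded f -> norm_bounded g ->
    M (fun y => f y + g y) = M f + M g)
  (MZ : forall c f, norm_bounded f -> M (fun y => c * f y) = c * M f)
  (M_ge0 : forall f, norm_bounded f -> (forall y, 0 <= f y) -> 0 <= M f)
  (M1 : M (cst 1) = 1)
  (M_tight : forall e, 0 < e -> exists2 F : set S, finite_set F & 1 - e <= M \1_F).

Lemma bounded_unit f : (forall y, 0 <= f y <= 1) -> norm_bounded f.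
Proof.
by move=> f01; exists 1 => y; have /andP[f0 f1] := f01 y; rewrite ger0_norm.
Qed.

Lemma indic_unit (A : set S) y : 0 <= (\1_A y : R) <= 1.
Proof. by rewrite indicE; case: (_ \in _); rewrite /= ?lexx ler01. Qed.

Let bounded_indic (A : set S) : norm_bounded (\1_A : S -> R).
Proof. exact/bounded_unit/indic_unit. Qed.

Lemma mean_le f g : norm_bounded f -> norm_bounded g -> (forall y, f y <= g y) ->
  M f <= M g.
Proof.
move=> bf [m gm] fg; have [m' fm] := bf; have bh : norm_bounded (fun y => g y - f y).
  by exists (m + m') => y; apply: le_trans (ler_normB _ _) _; rewrite lerD.
have -> : g = (fun y => f y + (g y - f y)).
  by apply/funext => y; rewrite addrC subrK.
by rewrite MD// lerDl M_ge0// => y; rewrite subr_ge0.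
Qed.

Lemma mean_sum (s : seq S) g :
  norm_bounded (fun y => \sum_(z <- s) g z * \1_[set z] y) /\
  M (fun y => \sum_(z <- s) g z * \1_[set z] y) = \sum_(z <- s) g z * M \1_[set z].
Proof.
elim: s => [|z s [bs IH]].
  split; first by exists 0 => y; rewrite big_nil normr0.
  rewrite big_nil; have -> : (fun y => \sum_(z <- [::]) g z * \1_[set z] y) =
      (fun y => 0 * \1_set0 y) by apply/funext => y; rewrite big_nil mul0r.
  by rewrite MZ// mul0r.
have E : (fun y => \sum_(z <- z :: s) g z * \1_[set z] y) =
    (fun y => g z * \1_[set z] y + \sum_(z <- s) g z * \1_[set z] y).
  by apply/funext => y; rewrite big_cons.
have bz : norm_bounded (fun y => g z * \1_[set z] y).
  exists `|g z| => y; rewrite normrM ler_piMr//.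
  by have /andP[f0 f1] := indic_unit [set z] y; rewrite ger0_norm.
rewrite E big_cons -IH MD// MZ//; split=> //.
have [m bm] := bz; have [m' bm'] := bs; exists (m + m') => y.
by apply: le_trans (ler_normD _ _) _; rewrite lerD.
Qed.

Lemma sum_indic1 (s : seq S) g y : uniq s ->
  \sum_(z <- s) g z * \1_[set z] y = if y \in s then g y else 0.
Proof.
move=> us; rewrite (eq_bigr (fun z => if z == y then g z else 0)); last first.
  move=> z _; rewrite indicE; case: eqP => [->|zy].
    by rewrite mem_set//= mulr1.
  by rewrite memNset ?mulr0//= => yz; exact: zy.
rewrite -big_mkcond; case: ifPn => ys.
  by rewrite (big_rem y)//= eqxx big1_seq ?addr0// => z; rewrite mem_rem_uniq// inE; case: eqP.
by rewrite big1_seq// => z /andP[/eqP-> ys']; rewrite ys' in ys.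
Qed.

Let w z : \bar R := (M \1_[set z])%:E.

Let w_ge0 z : (0 <= w z)%E.
Proof. by rewrite lee_fin M_ge0// => y; case/andP: (indic_unit [set z] y). Qed.

(** Finite subsums are means of functions below [g]. Only an inequality results, as mass could still
    escape to infinity. *)
Lemma weight_le g : (forall y, 0 <= g y <= 1) ->
  (\esum_(z in [set: S]) ((g z)%:E * w z) <= (M g)%:E)%E.
Proof.
move=> g01; apply: ge_ereal_sup => _ [F [finF _] <-].
rewrite fsbig_finite//=; under eq_bigr do rewrite -EFinM.
rewrite sumEFin lee_fin; have [bs <-] := mean_sum (finmap.enum_fset (fset_set F)) g.
apply: mean_le => // [|y]; first exact: bounded_unit.
by rewrite sum_indic1 ?finmap.fset_uniq//; case: ifP => // _; case/andP: (g01 y).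
Qed.

Let w1 : \esum_(z in [set: S]) w z = 1%E.
Proof.
apply/eqP; rewrite eq_le; apply/andP; split.
  have := @weight_le (cst 1); rewrite M1; under eq_esum do rewrite mul1e.
  by apply=> y; rewrite ler01 lexx.
apply/lee_addgt0Pr => e e0; have [F finF MF] := M_tight e0.
rewrite -leeBlDr// -EFinB; apply: le_trans (_ : (M \1_F)%:E <= _)%E.
  by rewrite lee_fin.
apply: esum_ge; exists F; first by split.
rewrite fsbig_finite//= sumEFin lee_fin.
have [bs E] := mean_sum (finmap.enum_fset (fset_set F)) (cst 1).
under eq_bigr do rewrite -[M _]mul1r.
rewrite -E; apply: mean_le => // y; rewrite sum_indic1 ?finmap.fset_uniq// in_fset_set//.
by rewrite indicE; case: (_ \in _).
Qed.

(* A finitely additive mean on a countable set is a probability as soon as it is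
   tight: the inequality between the integral and the mean, applied to [g] and
   to [1 - g], is an equality. *)
Lemma tight_mean_probability : exists p : probability (discrete S) R,
  forall g, (forall y, 0 <= g y <= 1) -> (\int[p]_z (g z)%:E = (M g)%:E)%E.
Proof.
pose p : probability (discrete S) R := weight_probability w_ge0 w1.
have pE z : p [set z] = w z by exact: esum_set1.
have le g : (forall y, 0 <= g y <= 1) -> (\int[p]_z (g z)%:E <= (M g)%:E)%E.
  move=> g01; rewrite integral_discrete => [|y]; last by case/andP: (g01 y); rewrite lee_fin.
  by apply: le_trans (weight_le g01); apply: le_esum => z _; rewrite pE.
exists p => g g01; apply/eqP; rewrite eq_le le//=.
have g01' y : 0 <= 1 - g y <= 1.
  by have /andP[g0 g1] := g01 y; rewrite subr_ge0 g1/= lerBlDr lerDl.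
have M1g : M (fun y => 1 - g y) = 1 - M g.
  have bg := bounded_unit g01; have bc := bounded_unit g01'.
  apply: (addIr (M g)); rewrite -MD// subrK -[RHS]M1; congr M.
  by apply/funext => y; rewrite subrK.
have fin : (\int[p]_z (1 - g z)%:E \is a fin_num)%E.
  rewrite ge0_fin_numE; last first.
    by apply: integral_ge0 => z _; rewrite lee_fin; case/andP: (g01' z).
  exact: le_lt_trans (le _ g01') (ltry _).
have : (\int[p]_z (g z)%:E + \int[p]_z (1 - g z)%:E = 1)%E.
  rewrite !integral_discrete => [||y]; last 2 first.
  - by move=> y; rewrite lee_fin; case/andP: (g01' y).
  - by case/andP: (g01 y); rewrite lee_fin.
  rewrite -esumD => [|z _|z _]; last 2 first.
  - by rewrite mule_ge0// lee_fin; case/andP: (g01 z).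
  - by rewrite mule_ge0// lee_fin; case/andP: (g01' z).
  rewrite -w1; apply: eq_esum => z _; rewrite pE -!EFinM -EFinD; congr _%:E; ring.
move=> /esym /eqP; rewrite -sube_eq// => [/eqP <-|]; last first.
  by rewrite fin_num_adde_defl.
rewrite leeBrDr// -leeBrDl// -EFinB -M1g; exact: le.
Qed.

End TightMean.

(** * Stationary means for the crystal generator *)

Section GeneratorMean.
Context {R : realType} (b0 b1 b2 : R) {n : nat}.
Context (b0_gt0 : 0 < b0) (b01 : b0 < b1) (b12 : b1 < b2) (n_ge2 : (2 <= n)%N).
Implicit Types (x y : config n) (f g : config n -> R) (h t e : R).
Local Notation gen := (gen b0 b1 b2).
Local Notation step := (euler_step b0 b1 b2).
Local Notation B := (n%:R * b2).

Lemma euler_stepD h f g x : step h (fun y => f y + g y) x = step h f x + step h g x.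
Proof.
rewrite /euler_step; suff -> : gen (fun y => f y + g y) x = gen f x + gen g x by ring.
by rewrite /gen -big_split; apply: eq_bigr => i _ /=; ring.
Qed.

Lemma euler_stepZ h c f x : step h (fun y => c * f y) x = c * step h f x.
Proof. by rewrite /euler_step gen_scale; ring. Qed.

Lemma euler_step_cst h c x : step h (cst c) x = c.
Proof. by rewrite /euler_step /gen big1 ?mulr0 ?addr0// => i _; rewrite subrr mulr0. Qed.

(** One step gives at most [(1 - h * a) * W + h * G], an affine recursion with fixed point
    [G / a]. *)
Lemma iter_euler_lyapunov (W : config n -> R) a G h k x : 0 < a -> 0 <= h ->
  h * B <= 1 -> h * a <= 1 -> 0 <= G -> (forall x, 0 <= W x) ->
  (forall x, gen W x <= G - a * W x) ->
  iter k (step h) W x <= W x + G / a.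
Proof.
move=> a0 h0 hB ha G0 W0 drift; have aV : a * (G / a) = G by rewrite mulrC divfK// gt_eqF.
elim: k x => [|k IH] x; first by rewrite lerDl divr_ge0// ltW.
have c0 : 0 <= 1 - h * a by rewrite subr_ge0.
rewrite iterSr; apply: (@le_trans _ _
    (iter k (step h) (fun y => (1 - h * a) * W y + h * G) x)).
  apply: (iterK_le (euler_stepD h)) => [f f0|y]; first exact: euler_step_ge0.
  by have := ler_wpM2l h0 (drift y); rewrite /euler_step; lra.
rewrite (iterKD (euler_stepD h)) (iterKZ (euler_stepZ h) k _ W).
rewrite (iterK1 (euler_stepZ h) (euler_step_cst h 1)).
have := ler_wpM2l c0 (IH x); have := mulr_ge0 (mulr_ge0 h0 (ltW a0)) (W0 x).
have : h * a * (G / a) = h * G by rewrite -mulrA aV.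
by move: (G / a) (iter k _ W x) => q I; lra.
Qed.

(** Invariance under Euler steps of every size amounts to [L] vanishing on [gen f] for bounded
    [f]. *)
Record stationary_mean (L : (config n -> R) -> R) : Prop := {
  meanD : forall f g, norm_bounded f -> norm_bounded g ->
    L (fun y => f y + g y) = L f + L g;
  meanZ : forall c f, norm_bounded f -> L (fun y => c * f y) = c * L f;
  mean_ge0 : forall f, norm_bounded f -> (forall y, 0 <= f y) -> 0 <= L f;
  mean1 : L (cst 1) = 1;
  mean_euler : forall h f, norm_bounded f -> L (step h f) = L f
}.

Lemma gen_bounded f : norm_bounded f -> norm_bounded (gen f).
Proof.
move=> [m fm]; exists (B * (m + m)) => x; apply: gen_bound => // i.
by apply: le_trans (ler_normB _ _) _; rewrite lerD.
Qed.

Lemma exists_stationary_mean_exp : exists L C s, [/\ stationary_mean L, 0 < C, 0 < s &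
  forall (A : set (config n)) (k : nat),
    (forall x, A x -> exists i, k%:R <= `|(x i)%:R - (x (ordS i))%:R| :> R) ->
    L \1_A <= C * expR (- (s * k%:R))].
Proof.
have [W [a [G [s [a0 s0 drift lower]]]]] := exists_exp_lyapunov b0_gt0 b01 b12 n_ge2.
have n0 : (0 < n)%N := ltnW n_ge2.
have B0 : 0 < B by rewrite mulr_gt0 ?ltr0n// (b2_gt0 b0_gt0 b01 b12).
(* This size gives both [h * B <= 1], for positivity of the step, and [h * a <= 1], for the Lyapunov
   recursion. *)
pose h := (B + a)^-1; have Ba0 : 0 < B + a by rewrite addr_gt0.
have h0 : 0 < h by rewrite invr_gt0.
have hB : h * B <= 1 by rewrite ler_pdivrMl// mulr1 lerDl ltW.
have ha : h * a <= 1 by rewrite ler_pdivrMl// mulr1 lerDr ltW.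
have K0 f : (forall x, 0 <= f x) -> forall x, 0 <= step h f x.
  by move=> f0; apply: euler_step_ge0 => //; exact: ltW.
pose x0 : config n := [ffun=> 0%N].
have KD := euler_stepD h; have KZ := euler_stepZ h; have K1 := euler_step_cst h 1.
have [L [LD LZ LK Lb]] := exists_stationary_mean x0 KD KZ K0 K1.
have drift' x : gen W x <= `|G| - a * W x.
  by apply: le_trans (drift x) _; rewrite lerD2r ler_norm.
have W0 x : 0 < W x by exact: lt_le_trans (expR_gt0 _) (lower x (Ordinal n0)).
have Wb k : iter k (step h) W x0 <= W x0 + `|G| / a.
  by apply: iter_euler_lyapunov => // [|x]; exact: ltW.
exists L, (W x0 + `|G| / a), s; split => //; last 2 first.
- by rewrite ltr_wpDr// divr_ge0// ltW.
- move=> A k far; have bA : norm_bounded (\1_A : config n -> R).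
    by exists 1 => x; rewrite indicE ger0_norm//; case: (_ \in _).
  apply: (proj2 (andP (Lb _ _ 0 bA _))) => j; apply/andP; split.
    by apply: iterK_ge0 => // x; rewrite indicE; case: (_ \in _).
  (* The mean is never applied to the unbounded [W]. The indicator is dominated by [W] scaled by
     [expR (- (s * k%:R))], and a bound along the orbit of [x0] passes to the mean. *)
  apply: (@le_trans _ _ (iter j (step h) (fun x => expR (- (s * k%:R)) * W x) x0)).
    apply: (iterK_le KD K0) => x; rewrite indicE.
    have [Ax|Ax] := pselect (A x); last by rewrite memNset// mulr_ge0 ?expR_ge0// ltW.
    rewrite mem_set//; have [i ki] := far x Ax.
    rewrite expRN mulrC ler_pdivlMr ?expR_gt0// mul1r.
    by apply: le_trans (lower x i); rewrite ler_expR ler_pM2l.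
  by rewrite (iterKZ KZ) mulrC ler_wpM2r ?expR_ge0.
split=> //.
- move=> f [m fm] f0; have : 0 <= L f <= m; last by case/andP.
  apply: Lb; first by exists m.
  move=> k; rewrite iterK_ge0//=; apply: le_trans (ler_norm _) _.
  exact: (iterK_bound KD KZ K0 K1).
- have : 1 <= L (cst 1) <= 1; last by move/andP=> [? ?]; apply/eqP; rewrite eq_le; apply/andP.
  apply: Lb; first by exists 1 => y; rewrite normr1.
  by move=> k; rewrite (iterK1 KZ K1) lexx.
- move=> h' f bf; have bg := gen_bounded bf.
  have bhg c : norm_bounded (fun x => c * gen f x).
    have [m gm] := bg; exists (`|c| * m) => x; by rewrite normrM ler_wpM2l.
  (* Invariance under the single size [h] forces [L (gen f) = 0], hence invariance for every
     size. *)
  have E c : L (step c f) = L f + c * L (gen f) by rewrite -LZ// -LD.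
  have := LK f bf; rewrite E -[RHS]addr0 => /addrI/eqP.
  by rewrite mulf_eq0 gt_eqF//= => /eqP gen0; rewrite E gen0 mulr0 addr0.
Qed.

Context (L : (config n -> R) -> R) (Lm : stationary_mean L).

Lemma stationary_mean_cst c : L (cst c) = c.
Proof.
have -> : cst c = (fun y => c * cst 1 y) :> (config n -> R).
  by apply/funext => y /=; rewrite mulr1.
rewrite (meanZ Lm) ?(mean1 Lm) ?mulr1//; by exists 1 => y; rewrite normr1.
Qed.

Lemma stationary_mean_close f g e : norm_bounded f -> norm_bounded g ->
  (forall x, `|f x - g x| <= e) -> `|L f - L g| <= e.
Proof.
move=> bf bg fg.
have le f1 f2 : norm_bounded f1 -> norm_bounded f2 -> (forall x, f1 x <= f2 x + e) ->
    L f1 <= L f2 + e.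
  move=> b1' b2' H; have [m fm] := b1'; have [m' fm'] := b2'.
  have be : norm_bounded (fun x => f2 x + cst e x).
    exists (m' + `|e|) => x; by apply: le_trans (ler_normD _ _) _; rewrite lerD.
  have bd : norm_bounded (fun x => f2 x + cst e x - f1 x).
    exists (m' + `|e| + m) => x; apply: le_trans (ler_normB _ _) _; rewrite lerD//.
    by apply: le_trans (ler_normD _ _) _; rewrite lerD.
  have be' : norm_bounded (cst e : config n -> R) by exists `|e|.
  rewrite -[X in _ + X](stationary_mean_cst e) -(meanD Lm)//.
  have -> : (fun y => f2 y + cst e y) = (fun y => f1 y + (f2 y + cst e y - f1 y)).
    by apply/funext => y; rewrite [RHS]addrC subrK.
  by rewrite (meanD Lm)// lerDl (mean_ge0 Lm)// => x; rewrite subr_ge0.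
have := le f g bf bg; have := le g f bg bf; rewrite ler_norml => H1 H2.
have K1 : L g <= L f + e.
  by apply: H1 => x; have := fg x; rewrite ler_norml => /andP[? ?]; lra.
have K2 : L f <= L g + e.
  by apply: H2 => x; have := fg x; rewrite ler_norml => /andP[? ?]; lra.
by apply/andP; split; lra.
Qed.

Lemma stationary_mean_iter k h f : 0 <= h -> h * B <= 1 -> norm_bounded f ->
  norm_bounded (iter k (step h) f) /\ L (iter k (step h) f) = L f.
Proof.
move=> h0 hB bf; elim: k => [//|k [[m fm] IH]] /=.
split; first by exists m => x; exact: euler_step_contraction.
by rewrite (mean_euler Lm)//; exists m.
Qed.

Context {d : measure_display} {Omega : measurableType d}
  (P : config n -> probability Omega R) (X : R -> Omega -> config n)
  (XP : crystal_growth_process b0 b1 b2 P X).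

Lemma stationary_mean_trans t (A : set (config n)) : 0 <= t ->
  L (fun x => trans P X t x A) = L \1_A.
Proof.
rewrite le_eqVlt => /predU1P[<-|t0].
  by congr L; apply/funext => x; rewrite (trans0 XP).
apply/eqP; rewrite -subr_eq0 -normr_le0; apply/ler_addgt0Pr => e e0; rewrite add0r.
have [N [h [h0 hB app]]] := trans_approx b0_gt0 b01 b12 (ltnW n_ge2) XP t0 e0.
have bA : norm_bounded (\1_A : config n -> R).
  by exists 1 => x; rewrite indicE ger0_norm//; case: (_ \in _).
have [bi <-] := stationary_mean_iter N (ltW h0) hB bA.
apply: stationary_mean_close => //.
by exists 1 => x; rewrite ger0_norm ?trans_ge0// (trans_le1 XP)// ltW.
Qed.

End GeneratorMean.

Section InvariantMeasure.
Context {R : realType} (b0 b1 b2 : R) {n : nat}.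
Context (b0_gt0 : 0 < b0) (b01 : b0 < b1) (b12 : b1 < b2) (n_ge2 : (2 <= n)%N).
Context {d : measure_display} {Omega : measurableType d}
  (P : config n -> probability Omega R) (X : R -> Omega -> config n)
  (XP : crystal_growth_process b0 b1 b2 P X)
  (lift : dstate n -> config n) (liftK : cancel lift (@Delta n)).
Implicit Types (x : config n) (z y : dstate n).
Local Notation PD := (fun z : dstate n => P (lift z)).
Local Notation DX := (fun (t : R) (w : Omega) => Delta (X t w)).

Lemma finite_differences k : finite_set [set z : dstate n | forall i, (`|val z i| < k)%N].
Proof.
pose F (u : {ffun 'I_n -> 'I_k.*2.+1}) : dstate n :=
  (* Tuples whose entries do not sum to zero are sent to the default [point]; this only enlarges the
     finite image. *)
  insubd (point : dstate n) [ffun i => (u i : nat)%:Z - k%:Z].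
apply: (@sub_finite_set _ _ (F @` [set: {ffun 'I_n -> 'I_k.*2.+1}])); last first.
  exact/finite_image/finite_finset.
move=> z /= zk; exists [ffun i => inord (absz (val z i + k%:Z))] => //.
apply: val_inj; rewrite val_insubd.
have -> : [ffun i => ([ffun i => inord (absz (val z i + k%:Z))] i : 'I_k.*2.+1) %:Z - k%:Z] = val z.
  apply/ffunP => i; rewrite !ffunE inordK; have := zk i; move: (val z i) => v; clear; lia.
by rewrite (valP z).
Qed.

Lemma exists_invariant : exists p : probability (discrete (dstate n)) R,
  invariant_measure PD DX p /\ exponentially_decaying_tails p.
Proof.
have [L [C [s [Lm C0 s0 tail]]]] := exists_stationary_mean_exp b0_gt0 b01 b12 n_ge2.
(* The image of the mean under [Delta]: the tail bound concerns differences only, so tightness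
   appears here. *)
pose M (g : dstate n -> R) := L (fun x => g (Delta x)).
have bDelta (g : dstate n -> R) : norm_bounded g -> norm_bounded (fun x => g (Delta x)).
  by move=> [m gm]; exists m.
have tailM (A : set (dstate n)) (k : nat) :
    (forall z, A z -> exists i, k%:Z <= `|val z i|) -> M \1_A <= C * expR (- (s * k%:R)).
  move=> Ak; have -> : M \1_A = L \1_[set x | A (Delta x)].
    by congr L; apply/funext => x; rewrite !indicE; congr (nat_of_bool _)%:R; rewrite !inE.
  apply: tail => x /Ak[i ki]; exists i; move: ki; rewrite /= ffunE => ki.
  rewrite -[X in `|X - _|]/((x i)%:Z%:~R) -[X in `|_ - X|]/((x (ordS i))%:Z%:~R).
  by rewrite -rmorphB/= -intr_norm -[leLHS]/(k%:Z%:~R) ler_int.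
have M1g (A : set (dstate n)) : M \1_A = 1 - M \1_(~` A).
  have bi (D : set (dstate n)) : norm_bounded (fun x => \1_D (Delta x) : R).
    by exists 1 => x; rewrite indicE ger0_norm//; case: (_ \in _).
  apply/eqP; rewrite eq_sym subr_eq -(meanD Lm)// -(mean1 Lm); apply/eqP; congr L.
  by apply/funext => x; rewrite !indicE in_setC; case: (_ \in _); rewrite /= ?addr0 ?add0r.
have [|||||p pE] := @tight_mean_probability R n M.
- by move=> f g bf bg; exact: (meanD Lm (bDelta _ bf) (bDelta _ bg)).
- by move=> c f bf; exact: (meanZ Lm c (bDelta _ bf)).
- by move=> f bf f0; exact: (mean_ge0 Lm (bDelta _ bf)).
- exact: (mean1 Lm).
(* Since [1 + s * k%:R <= expR (s * k%:R)], any [k] above [C / (s * e)] brings the tail below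
   [e]. *)
- move=> e e0; pose k := Num.bound (C / (s * e)).
  exists [set z : dstate n | forall i, (`|val z i| < k)%N]; first exact: finite_differences.
  rewrite M1g lerD2l lerN2; apply: le_trans (tailM _ k _) _.
    move=> z /= /existsNP[i /negP]; rewrite -leqNgt => ki; exists i.
    by rewrite -abszE lez_nat.
  rewrite expRN ler_pdivrMr ?expR_gt0//.
  have k1 : C / (s * e) < k%:R by apply: archi_boundP; rewrite divr_ge0 ?mulr_ge0// ltW.
  move: k1; rewrite ltr_pdivrMr ?mulr_gt0// => k1.
  have := ler_wpM2l (ltW e0) (expR_ge1Dx (s * k%:R)); lra.
have pA (A : set (dstate n)) : p A = (M \1_A)%:E.
  rewrite -pE; last exact: indic_unit.
  by rewrite integral_indic// setIT.
exists p; split.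
- move=> t A t0; rewrite pA.
  pose g z := trans P X t (lift z) [set x | A (Delta x)].
  transitivity (\int[p]_z (g z)%:E)%E.
    by apply: eq_integral => z _; rewrite /g (transE XP).
  rewrite pE => [|z]; last by rewrite trans_ge0 (trans_le1 XP).
  congr _%:E; transitivity (L (fun x => trans P X t x [set x | A (Delta x)])).
    (* The representative [lift (Delta x)] may be replaced by [x], as both have the same
       differences. *)
    congr L; apply/funext => x.
    by apply: (trans_Delta b0_gt0 b01 b12 (ltnW n_ge2) XP) => //; rewrite liftK.
  exact: (stationary_mean_trans b0_gt0 b01 b12 n_ge2 Lm XP).
- exists C, s; split=> // k i; rewrite pA lee_fin; apply: tailM => z /= zk.
  by exists i.
Qed.

End InvariantMeasure.

(* The process [Delta X] started from [z] is realised by starting [X] from any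
   configuration [lift z] whose differences are [z]; the choice is arbitrary. *)
Theorem theorem1p1 (R : realType) (b0 b1 b2 : R)
    (b0_gt0 : 0 < b0) (b01 : b0 < b1) (b12 : b1 < b2)
    (n : nat) (n_ge2 : (2 <= n)%N)
    (d : measure_display) (Omega : measurableType d)
    (P : config n -> probability Omega R) (X : R -> Omega -> config n)
    (XP : crystal_growth_process b0 b1 b2 P X)
    (lift : dstate n -> config n) (liftK : cancel lift (@Delta n)) :
  let PD : dstate n -> probability Omega R := fun z => P (lift z) in
  let DX : R -> Omega -> dstate n := fun t w => Delta (X t w) in
  positive_recurrent PD DX /\
  exists pi : probability (discrete (dstate n)) R,
    [/\ invariant_measure PD DX pi,
        forall pi' : probability (discrete (dstate n)) R,
          invariant_measure PD DX pi' -> forall A : set (dstate n), pi' A = pi A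
      & exponentially_decaying_tails pi].
Proof.
move=> PD DX.
have [p [p_inv p_tail]] := exists_invariant b0_gt0 b01 b12 n_ge2 XP liftK.
have irr := difference_irreducible b0_gt0 b01 b12 XP liftK.
have DXm := difference_measurable XP.
split.
  split=> // z; have [h h0 hz] := difference_leave b0_gt0 b01 b12 n_ge2 XP liftK z.
  apply: (return_time_integrable (h := h) DXm _ _ p_inv) => //.
  - exact: (difference_start XP liftK).
  - exact: (difference_markov b0_gt0 b01 b12 n_ge2 XP liftK).
  - exact: (invariant_pos irr).
exists p; split=> // p' p'_inv A; exact: (invariant_unique DXm irr).
Qed.
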